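(* Let $k$ be a field, let $Q$ be an acyclic quiver with $n$ vertices and let $v$ be a sink of $Q$. Then for any $0\le i\le n$, there is a bijection between $\mathsf{rigid}^i(kQ)$ and $\mathsf{rigid}^i(k(\mu_vQ))$.
   Context: Quivers are finite. $kQ$ is the path algebra and $kQ$-modules are finitely generated. A sink of $Q$ is a vertex $v$ such that no arrow starts at $v$; for a sink $v$, the sink mutation $\mu_vQ$ is the quiver obtained from $Q$ by reversing all arrows which end at $v$. A module is basic if it is a direct sum of pairwise non-isomorphic indecomposables; $|U|$ is the number of non-isomorphic indecomposable direct summands of $U$. A module $U$ is rigid if $\operatorname{Ext}^1(U,U)=0$. For an algebra $\Lambda$ and an integer $i\ge 0$, $\mathsf{rigid}^i\Lambda$ is the set of isomorphism classes of basic rigid $\Lambda$-modules $U$ with $|U|=i$. *)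

(* Defs.v *)
From HB Require Import structures.
From mathcomp Require Import all_boot all_algebra finmap.
From mathcomp.multinomials Require Import monalg.

Set Implicit Arguments.
Unset Strict Implicit.
Unset Printing Implicit Defensive.

Import GRing.Theory.
Local Open Scope ring_scope.

Record quiver := Quiver {
  vertex : finType;
  arrow : finType;
  source : arrow -> vertex;
  target : arrow -> vertex
}.

Section Paths.
Variable Q : quiver.

Fixpoint is_qpath (x : vertex Q) (s : seq (arrow Q)) : bool :=
  if s is a :: s' then (source a == x) && is_qpath (target a) s' else true.

(* A path is given by its starting vertex and the arrows in the order in which
   they are traversed; the starting vertex with no arrow is the lazy path. *)
Record qpath : predArgType := QPath {
  qpath_val : vertex Q * seq (arrow Q);
  _ : is_qpath qpath_val.1 qpath_val.2
}.

HB.instance Definition _ := [isSub for qpath_val].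
HB.instance Definition _ := [Countable of qpath by <:].

Definition psource (p : qpath) : vertex Q := (val p).1.
Definition parrows (p : qpath) : seq (arrow Q) := (val p).2.
Definition ptarget (p : qpath) : vertex Q :=
  last (psource p) (map (@target Q) (parrows p)).

Definition lazy_path (x : vertex Q) : qpath := @QPath (x, [::]) isT.

Lemma is_qpath_cat x s t :
  is_qpath x (s ++ t) =
  is_qpath x s && is_qpath (last x (map (@target Q) s)) t.
Proof. by elim: s x => //= a s IHs x; rewrite IHs andbA. Qed.

Lemma pconcat_subproof (p q : qpath) : ptarget p = psource q ->
  is_qpath (psource p, parrows p ++ parrows q).1
           (psource p, parrows p ++ parrows q).2.
Proof.
move=> e; rewrite /= is_qpath_cat -/(ptarget p) e.
by apply/andP; split; [exact: (valP p)|exact: (valP q)].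
Qed.

(* [pconcat p q] is the path "p, then q", or [None] if p does not end where
   q starts. *)
Definition pconcat (p q : qpath) : option qpath :=
  if @eqP _ (ptarget p) (psource q) is ReflectT e
  then Some (QPath (pconcat_subproof e)) else None.

Lemma pconcatP (p q r : qpath) :
  pconcat p q = Some r <->
  ptarget p = psource q /\ val r = (psource p, parrows p ++ parrows q).
Proof.
rewrite /pconcat; case: eqP => [e|ne]; last by split=> // -[].
by split=> [[<-]//|[_ er]]; congr Some; apply: val_inj.
Qed.

Lemma pconcat_some (p q : qpath) : ptarget p = psource q ->
  exists2 r, pconcat p q = Some r &
    val r = (psource p, parrows p ++ parrows q).
Proof.
move=> e; exists (QPath (pconcat_subproof e)) => //.
by apply/pconcatP.
Qed.

Lemma pconcat_none (p q : qpath) : ptarget p != psource q ->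
  pconcat p q = None.
Proof. by rewrite /pconcat; case: eqP. Qed.

Lemma pconcat_source p q r : pconcat p q = Some r -> psource r = psource p.
Proof. by move=> /pconcatP[_]; rewrite /psource => ->. Qed.

Lemma pconcat_target p q r : pconcat p q = Some r -> ptarget r = ptarget q.
Proof.
move=> /pconcatP[e er]; rewrite /ptarget {1}/psource {1}/parrows er /=.
by rewrite map_cat last_cat -/(ptarget p) e.
Qed.

Lemma pconcatA (p q r : qpath) :
  obind (pconcat p) (pconcat q r) = obind (pconcat^~ r) (pconcat p q).
Proof.
have [epq|npq] := eqVneq (ptarget p) (psource q); last first.
  rewrite [pconcat p q]pconcat_none //=.
  case E: (pconcat q r) => [s|] //=.
  by rewrite pconcat_none // (pconcat_source E).
have [pq Epq vpq] := pconcat_some epq; rewrite Epq /=.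
have [eqr|nqr] := eqVneq (ptarget q) (psource r); last first.
  by rewrite !pconcat_none //= (pconcat_target Epq).
have [qr Eqr vqr] := pconcat_some eqr; rewrite Eqr /=.
have [|s Es vs] := @pconcat_some p qr; first by rewrite (pconcat_source Eqr).
have [|t Et vt] := @pconcat_some pq r; first by rewrite (pconcat_target Epq).
rewrite Es Et; congr Some; apply: val_inj; rewrite vs vt.
by rewrite /parrows vqr vpq /= catA (pconcat_source Epq).
Qed.

Lemma pconcat_lazyl x (p : qpath) :
  pconcat (lazy_path x) p = if x == psource p then Some p else None.
Proof.
case: eqP => [e|/eqP ne]; last by rewrite pconcat_none.
by apply/pconcatP; split=> //; rewrite /= e; case: (p) => -[].
Qed.

Lemma pconcat_lazyr x (p : qpath) :
  pconcat p (lazy_path x) = if x == ptarget p then Some p else None.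
Proof.
case: eqP => [e|/eqP ne]; last by rewrite pconcat_none // eq_sym.
by apply/pconcatP; split=> //; rewrite /= cats0; case: (p) => -[].
Qed.

Definition acyclic : Prop :=
  forall p : qpath, psource p = ptarget p -> parrows p = [::].

Definition is_sink (v : vertex Q) : Prop := forall a : arrow Q, source a <> v.

(* Meant for a sink v: the arrows ending at v are reversed. *)
Definition mutation (v : vertex Q) : quiver :=
  @Quiver (vertex Q) (arrow Q)
    (fun a => if target a == v then target a else source a)
    (fun a => if target a == v then source a else target a).

End Paths.

Arguments is_sink {Q} v.
Arguments mutation {Q} v.

Section PathAlgebra.
Variables (k : fieldType) (Q : quiver).

Definition path_algebra : Type := {malg k[qpath Q]}.

HB.instance Definition _ := GRing.Lmodule.on path_algebra.

Implicit Types f g h : path_algebra.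

Definition path_elt (c : k) (o : option (qpath Q)) : path_algebra :=
  if o is Some p then << c *g p >> else 0.

Definition path_one : path_algebra :=
  \sum_(x : vertex Q) << 1 *g lazy_path x >>.

(* The product p q of two paths is "q, then p", as for composition of maps, so
   that left modules correspond to covariant representations of Q. *)
Definition path_mul f g : path_algebra :=
  \sum_(p <- msupp f) \sum_(q <- msupp g) path_elt (f@_p * g@_q) (pconcat q p).

Fact path_elt0 o : path_elt 0 o = 0.
Proof. by case: o => //= p; exact: monalgU0. Qed.

Fact path_eltD o : {morph path_elt^~ o : c d / c + d}.
Proof. by move=> c d; case: o => /= [p|]; rewrite ?monalgUD ?addr0. Qed.

Fact path_mulw (d1 d2 : {fset qpath Q}) f g :
  (msupp f `<=` d1)%fset -> (msupp g `<=` d2)%fset ->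
  path_mul f g =
  \sum_(p <- d1) \sum_(q <- d2) path_elt (f@_p * g@_q) (pconcat q p).
Proof.
move=> le1 le2; rewrite /path_mul (big_fset_incl _ le1) /=; last first.
  move=> p _ /mcoeff_outdom fp; rewrite big1 // => q _.
  by rewrite fp mul0r path_elt0.
apply: eq_bigr => p _; apply/big_fset_incl => // q _ /mcoeff_outdom ->.
by rewrite mulr0 path_elt0.
Qed.

Fact path_mulDl : left_distributive path_mul +%R.
Proof.
move=> f g h; set d := (msupp f `|` msupp g)%fset.
have lh : (msupp h `<=` msupp h)%fset by exact: fsubset_refl.
rewrite (path_mulw (msuppD_le f g) lh) (path_mulw (fsubsetUl _ (msupp g)) lh).
rewrite (path_mulw (fsubsetUr (msupp f) _) lh) -big_split; apply: eq_bigr => p _.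
rewrite -big_split; apply: eq_bigr => q _ /=.
by rewrite mcoeffD mulrDl path_eltD.
Qed.

Fact path_mulDr : right_distributive path_mul +%R.
Proof.
move=> h f g; set d := (msupp f `|` msupp g)%fset.
have lh : (msupp h `<=` msupp h)%fset by exact: fsubset_refl.
rewrite (path_mulw lh (msuppD_le f g)) (path_mulw lh (fsubsetUl _ (msupp g))).
rewrite (path_mulw lh (fsubsetUr (msupp f) _)) -big_split.
apply: eq_bigr => p _; rewrite -big_split; apply: eq_bigr => q _ /=.
by rewrite mcoeffD mulrDr path_eltD.
Qed.

Fact path_mul0r : left_zero 0 path_mul.
Proof. by move=> f; rewrite /path_mul msupp0 big_seq_fset0. Qed.

Fact path_mulr0 : right_zero 0 path_mul.
Proof.
by move=> f; rewrite /path_mul big1 // => p _; rewrite msupp0 big_seq_fset0.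
Qed.

Fact path_mulUU c d p q :
  path_mul << c *g p >> << d *g q >> = path_elt (c * d) (pconcat q p).
Proof.
by rewrite (path_mulw msuppU_le msuppU_le) !big_seq_fset1 !mcoeffUU.
Qed.

Fact path_mul_suml I (r : seq I) (F : I -> path_algebra) g :
  path_mul (\sum_(i <- r) F i) g = \sum_(i <- r) path_mul (F i) g.
Proof.
exact: (big_morph (path_mul^~ g) (fun _ _ => path_mulDl _ _ _) (path_mul0r _)).
Qed.

Fact path_mul_sumr I (r : seq I) (F : I -> path_algebra) f :
  path_mul f (\sum_(i <- r) F i) = \sum_(i <- r) path_mul f (F i).
Proof.
exact: (big_morph (path_mul f) (fun _ _ => path_mulDr _ _ _) (path_mulr0 _)).
Qed.

Fact path_algebraE f : f = \sum_(p <- msupp f) << f@_p *g p >>.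
Proof. exact: monalgE. Qed.

Fact path_mulA : associative path_mul.
Proof.
have El f g : path_mul f g = \sum_(p <- msupp f) path_mul << f@_p *g p >> g.
  by rewrite {1}[f]path_algebraE path_mul_suml.
have Er f g : path_mul f g = \sum_(q <- msupp g) path_mul f << g@_q *g q >>.
  by rewrite {1}[g]path_algebraE path_mul_sumr.
move=> f g h; rewrite (El f (path_mul g h)) (El f g) path_mul_suml.
apply: eq_bigr => p _; rewrite (El g h) path_mul_sumr (Er _ g) path_mul_suml.
apply: eq_bigr => q _; rewrite (Er _ h) path_mul_sumr (Er _ h).
apply: eq_bigr => r _.
rewrite !path_mulUU; have := pconcatA r q p.
case: (pconcat q p) => [s|]; case: (pconcat r q) => [t|] /= E.
- by rewrite !path_mulUU E mulrA.
- by rewrite path_mulUU path_mulr0 E.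
- by rewrite path_mulUU path_mul0r -E.
- by rewrite path_mulr0 path_mul0r.
Qed.

Fact path_mul1r : left_id path_one path_mul.
Proof.
move=> f; rewrite [f]path_algebraE path_mul_sumr; apply: eq_bigr => p _.
rewrite path_mul_suml (bigD1 (ptarget p)) //= path_mulUU mul1r.
rewrite pconcat_lazyr eqxx /= big1 ?addr0 // => x /negPf nx.
by rewrite path_mulUU pconcat_lazyr nx.
Qed.

Fact path_mulr1 : right_id path_one path_mul.
Proof.
move=> f; rewrite [f]path_algebraE path_mul_suml; apply: eq_bigr => p _.
rewrite path_mul_sumr (bigD1 (psource p)) //= path_mulUU mulr1.
rewrite pconcat_lazyl eqxx /= big1 ?addr0 // => x /negPf nx.
by rewrite path_mulUU pconcat_lazyl nx.
Qed.

(* Not an [nzRingType]: the path algebra of the empty quiver is zero. *)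
HB.instance Definition _ := GRing.Zmodule_isPzRing.Build path_algebra
  path_mulA path_mul1r path_mulr1 path_mulDl path_mulDr.

End PathAlgebra.

Section Modules.
Variable L : pzRingType.
Implicit Types U V A B : lmodType L.

Definition isomorphic U V : Prop := exists f : {linear U -> V}, bijective f.

Definition finitely_generated U : Prop :=
  exists (m : nat) (u : 'I_m -> U),
    forall x : U, exists c : 'I_m -> L, x = \sum_(i < m) c i *: u i.

Definition is_zero U : Prop := forall x : U, x = 0.

Definition dsum U V : lmodType L := (U * V)%type.

Definition zero_module : lmodType L := 'rV[L]_0.

Definition bigdsum (m : nat) (S : 'I_m -> lmodType L) : lmodType L :=
  \big[dsum/zero_module]_(j < m) S j.

Definition indecomposable U : Prop :=
  ~ is_zero U /\
  forall A B, isomorphic U (dsum A B) -> is_zero A \/ is_zero B.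

Definition direct_summand A U : Prop := exists B, isomorphic U (dsum A B).

Definition pairwise_noniso (m : nat) (S : 'I_m -> lmodType L) : Prop :=
  forall j l : 'I_m, isomorphic (S j) (S l) -> j = l.

Definition basic U : Prop :=
  exists (m : nat) (S : 'I_m -> lmodType L),
    [/\ forall j, indecomposable (S j),
        pairwise_noniso S
      & isomorphic U (bigdsum S)].

(* |U| = i: the family S is a set of representatives of the isomorphism classes
   of indecomposable direct summands of U. *)
Definition num_summands U (i : nat) : Prop :=
  exists S : 'I_i -> lmodType L,
    [/\ forall j, indecomposable (S j) /\ direct_summand (S j) U,
        pairwise_noniso S
      & forall A, indecomposable A -> direct_summand A U ->
          exists j, isomorphic A (S j)].

(* Short exact sequences 0 -> V -> E -> U -> 0. *)
Record extension U V := Extension {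
  ext_mod : lmodType L;
  ext_in : {linear V -> ext_mod};
  ext_out : {linear ext_mod -> U};
  ext_in_inj : injective ext_in;
  ext_out_surj : forall x, exists y, ext_out y = x;
  ext_exact : forall y, ext_out y = 0 <-> exists z, ext_in z = y
}.

Definition ext_equiv U V (e e' : extension U V) : Prop :=
  exists f : {linear ext_mod e -> ext_mod e'},
    [/\ bijective f,
        forall z, f (ext_in e z) = ext_in e' z
      & forall y, ext_out e' (f y) = ext_out e y].

Section SplitExtension.
Variables U V : lmodType L.

Definition split_in (z : V) : dsum U V := (0, z).

Fact split_in_linear : linear split_in.
Proof. by move=> a x y; congr pair; rewrite /= scaler0 addr0. Qed.

HB.instance Definition _ :=
  GRing.isLinear.Build L V (dsum U V) *:%R split_in split_in_linear.

Definition split_out (y : dsum U V) : U := y.1.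

Fact split_out_linear : linear split_out.
Proof. by []. Qed.

HB.instance Definition _ :=
  GRing.isLinear.Build L (dsum U V) U *:%R split_out split_out_linear.

Fact split_in_inj : injective split_in.
Proof. by move=> x y []. Qed.

Fact split_out_surj x : exists y, split_out y = x.
Proof. by exists (x, 0). Qed.

Fact split_exact y : split_out y = 0 <-> exists z, split_in z = y.
Proof.
split=> [|[z <-]//]; case: y => u z; rewrite /split_out /= => ->.
by exists z.
Qed.

Definition split_extension : extension U V :=
  @Extension U V (dsum U V) split_in split_out
    split_in_inj split_out_surj split_exact.

End SplitExtension.

(* Ext^1(U, V) is the group of equivalence classes of extensions (Yoneda), whose
   zero is the class of the split extension. *)
Definition Ext1_eq0 U V : Prop :=
  forall e : extension U V, ext_equiv e (split_extension U V).

Definition rigid U : Prop := Ext1_eq0 U U.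

Definition basic_rigid (i : nat) U : Prop :=
  [/\ finitely_generated U, basic U, rigid U & num_summands U i].

Definition rigid_classes (i : nat) : Type :=
  {C : lmodType L -> Prop | exists2 U, basic_rigid i U & C = isomorphic U}.

End Modules.

(* Main.v *)
Require Import Defs.
From HB Require Import structures.
From mathcomp Require Import all_boot all_algebra finmap.
From mathcomp.classical Require Import boolp classical_sets.
From mathcomp.multinomials Require Import monalg.

Set Implicit Arguments.
Unset Strict Implicit.
Unset Printing Implicit Defensive.

Import GRing.Theory.
Local Open Scope ring_scope.

(** Why sink mutation does not change the number of rigid modules.

    Let X be a representation of the quiver with v removed, and let M be the
    direct sum, over the arrows that end at v, of the components of X at their
    sources. A module over kQ amounts to such an X with a linear map f : M -> V
    (sink_rep_full), a module over the path algebra of the mutation to X with a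
    linear map g : K -> M (source_rep_full).

    Modules with f surjective and modules with g injective correspond to each
    other by 0 -> K -> M -> V -> 0; this is the reflection of Bernstein, Gelfand
    and Ponomarev (bgp). It respects isomorphism and direct sums, hence the
    number of indecomposable summands and basic modules, and it respects rigidity
    because the conditions for self-extensions to split on the two sides reduce to
    the same equation (split_sink_source).

    The remaining rigid modules are those that have the simple module at v as a
    summand. If f is neither injective nor surjective, the module has a non-split
    extension by that summand (sink_trivial_split), so for them f is injective,
    and dually g is surjective. Replacing f by a retraction g : V -> M of f
    (swap) is a second correspondence, for which a module is rigid on either side
    exactly when X is (ret_sink_source). The two correspondences together give the
    bijection (rigid_classes_mutation).

    Self-extensions are computed by cocycles on the arrows (rigid_cocycle,
    cocycle_rigid). Sections and retractions of linear maps exist in any dimension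
    by Zorn (linear_retraction); by acyclicity the finitely generated modules are
    the finite-dimensional ones (fg_rep). *)

(** * Isomorphisms and direct sums *)

Section Isomorphism.
Variable L : pzRingType.
Implicit Types U V W A B : lmodType L.

Definition lin U V (f : U -> V) (f_lin : linear f) : {linear U -> V} :=
  HB.pack f (GRing.isLinear.Build L U V *:%R f f_lin).

Lemma can_linear U V (f : {linear U -> V}) (g : V -> U) :
  cancel f g -> cancel g f -> linear g.
Proof. by move=> fg gf a x y; apply: (can_inj fg); rewrite linearP !gf. Qed.

Lemma isomorphicP U V : isomorphic U V <->
  exists (f : {linear U -> V}) (g : {linear V -> U}), cancel f g /\ cancel g f.
Proof.
split=> [[f [g fg gf]]|[f [g [fg gf]]]]; last by exists f; exists g.
by exists f, (lin (can_linear fg gf)).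
Qed.

Lemma iso_refl U : isomorphic U U.
Proof. by exists idfun; exists idfun. Qed.

Lemma iso_sym U V : isomorphic U V -> isomorphic V U.
Proof. by move=> /isomorphicP[f [g [fg gf]]]; exists g; exists f. Qed.

Lemma iso_trans U V W : isomorphic U V -> isomorphic V W -> isomorphic U W.
Proof.
move=> [f bf] [g bg]; exists (g \o f : {linear U -> W}).
exact: bij_comp.
Qed.

Lemma iso_dsum U U' V V' : isomorphic U U' -> isomorphic V V' ->
  isomorphic (dsum U V) (dsum U' V').
Proof.
move=> [f [f' ff' f'f]] [g [g' gg' g'g]].
have lfg : linear (fun x : dsum U V => (f x.1, g x.2) : dsum U' V').
  by move=> a x y; rewrite !linearP.
by exists (lin lfg); exists (fun y => (f' y.1, g' y.2)) => -[x y] /=;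
  rewrite ?ff' ?gg' ?f'f ?g'g.
Qed.

Lemma iso_dsumC U V : isomorphic (dsum U V) (dsum V U).
Proof.
have lsw U' V' : linear (fun x : dsum U' V' => (x.2, x.1) : dsum V' U') by [].
by exists (lin (lsw U V)); exists (lin (lsw V U)) => -[].
Qed.

Lemma iso_is_zero U V : isomorphic U V -> is_zero U -> is_zero V.
Proof. by move=> [f [g _ gf]] U0 y; rewrite -[y]gf (U0 (g y)) linear0. Qed.

Lemma is_zero_iso U V : is_zero U -> is_zero V -> isomorphic U V.
Proof.
move=> U0 V0; exists \0 => /=.
by exists (fun=> 0) => x /=; [rewrite (U0 x)|rewrite (V0 x)].
Qed.

Lemma is_zero_zero_module : is_zero (zero_module L).
Proof. by move=> x; rewrite thinmx0. Qed.

(** An extension of U' by itself is pulled back and pushed out along the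
    isomorphism to one of U by itself. *)
Lemma rigid_iso U U' :
  isomorphic U U' -> rigid U -> rigid U'.
Proof.
move=> /isomorphicP[f [g [fg gf]]] rU e.
have inj : injective (ext_in e \o f : U -> ext_mod e).
  by move=> x y /= /ext_in_inj/(can_inj fg).
have surj x : exists y, (g \o ext_out e) y = x.
  by have [y yE] := ext_out_surj e (f x); exists y; rewrite /= yE fg.
have exact_ y : (g \o ext_out e) y = 0 <-> exists z, (ext_in e \o f) z = y.
  rewrite /=; split=> [gy|[z <-]].
    have [|z <-] := (ext_exact y).1; first by rewrite -[LHS]gf gy linear0.
    by exists (g z); rewrite /= gf.
  by rewrite (ext_exact _).2 ?linear0 //; exists (f z).
have [h [h_bij h_in h_out]] := rU (@Extension _ U U _ (ext_in e \o f)
  (g \o ext_out e) inj surj exact_).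
have lF : linear (fun y : dsum U U => (f y.1, f y.2) : dsum U' U').
  by move=> c x y; congr pair; rewrite /= linearP.
exists (lin lF \o h); split.
- have [h' hh' h'h] := h_bij.
  exists (fun y => h' (g y.1, g y.2)) => y /=.
    by rewrite !fg -surjective_pairing hh'.
  by rewrite h'h /= !gf -surjective_pairing.
- move=> z; have := h_in (g z); rewrite /= gf => -> /=.
  by rewrite /split_in /= linear0 gf.
- by move=> y; have := h_out y; rewrite /= /split_out => ->; rewrite gf.
Qed.

End Isomorphism.

(** * Transport of summands along a correspondence of modules *)

Section Correspondence.
Variables L L' : pzRingType.

(** What is left of an additive equivalence when only its effect on isomorphism
    classes is kept. Such a relation transports everything that is said in terms
    of isomorphisms and direct decompositions. *)
Record correspondence (R : lmodType L -> lmodType L' -> Prop) : Prop := Corr {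
  corr_isol : forall U U' W, R U W -> isomorphic U U' -> R U' W;
  corr_isor : forall U W W', R U W -> isomorphic W W' -> R U W';
  corr_funl : forall U W W', R U W -> R U W' -> isomorphic W W';
  corr_funr : forall U U' W, R U W -> R U' W -> isomorphic U U';
  corr_suml : forall U W A B, R U W -> isomorphic U (dsum A B) ->
    exists A' B', [/\ R A A', R B B' & isomorphic W (dsum A' B')];
  corr_sumr : forall U W A' B', R U W -> isomorphic W (dsum A' B') ->
    exists A B, [/\ R A A', R B B' & isomorphic U (dsum A B)];
  corr_zerol : forall U W, R U W -> is_zero U -> is_zero W;
  corr_zeror : forall U W, R U W -> is_zero W -> is_zero U
}.

End Correspondence.

Lemma corr_sym (L L' : pzRingType) (R : lmodType L -> lmodType L' -> Prop) :
  correspondence R -> correspondence (fun W U => R U W).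
Proof.
move=> [il ir fl fr sl sr zl zr]; split.
- by move=> W W' U; apply: ir.
- by move=> W U U'; apply: il.
- by move=> W U U'; apply: fr.
- by move=> W W' U; apply: fl.
- by move=> W U A B; apply: sr.
- by move=> W U A B; apply: sl.
- by move=> W U; apply: zr.
- by move=> W U; apply: zl.
Qed.

Section Transport.
Variables (L L' : pzRingType) (R : lmodType L -> lmodType L' -> Prop).
Hypothesis cR : correspondence R.

Lemma corr_summand U W A : R U W -> direct_summand A U ->
  exists2 A', R A A' & direct_summand A' W.
Proof.
move=> rUW [B /(corr_suml cR rUW)[A' [B' [rA _ iW]]]].
by exists A' => //; exists B'.
Qed.

Lemma corr_indecomposable U W : R U W -> indecomposable U -> indecomposable W.
Proof.
move=> rUW [nzU dU]; split=> [/(corr_zeror cR rUW)//|A' B'].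
move=> /(corr_sumr cR rUW)[A [B [rA rB /dU[/(corr_zerol cR rA)|]]]].
  by left.
by move=> /(corr_zerol cR rB); right.
Qed.

Lemma corr_noniso m (S : 'I_m -> lmodType L) (S' : 'I_m -> lmodType L') :
  (forall j, R (S j) (S' j)) -> pairwise_noniso S -> pairwise_noniso S'.
Proof.
move=> rS nS j l ijl; apply: nS; apply: (corr_funr cR (rS j)).
exact: (corr_isor cR (rS l) (iso_sym ijl)).
Qed.

Lemma corr_bigdsum m (S : 'I_m -> lmodType L) W : R (bigdsum S) W ->
  exists2 S' : 'I_m -> lmodType L',
    forall j, R (S j) (S' j) & isomorphic W (bigdsum S').
Proof.
elim: m => [|m IHm] in S W *.
  rewrite /bigdsum big_ord0 => rW; exists (fun=> zero_module L') => [[]//|].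
  rewrite /bigdsum big_ord0; apply: is_zero_iso (@is_zero_zero_module _).
  exact: (corr_zerol cR rW (@is_zero_zero_module _)).
rewrite {1}/bigdsum big_ord_recl => /(corr_suml cR)/(_ (iso_refl _)).
move=> [A' [B' [rA /IHm[S' rS' iB] iW]]].
exists (fun j => if unlift ord0 j is Some l then S' l else A') => [j|].
  by case: unliftP => [l|] ->.
rewrite /bigdsum big_ord_recl unlift_none.
apply: iso_trans iW (iso_dsum (iso_refl _) _).
by under eq_bigr do rewrite liftK.
Qed.

Lemma corr_basic U W : R U W -> basic U -> basic W.
Proof.
move=> rUW [m [S [iS nS iU]]].
have [S' rS iW] := corr_bigdsum (corr_isol cR rUW iU).
exists m, S'; split=> // [j|]; first exact: corr_indecomposable (iS j).
exact: corr_noniso nS.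
Qed.

End Transport.

Lemma corr_num_summands (L L' : pzRingType) (R : lmodType L -> lmodType L' -> Prop) :
  correspondence R -> forall U W i, R U W -> num_summands U i -> num_summands W i.
Proof.
move=> cR U W i rUW [S [iS nS cS]].
have /choice[S' rS] j : exists A', R (S j) A' /\ direct_summand A' W.
  by have [A' rA sA] := corr_summand cR rUW (iS j).2; exists A'.
exists S'; split=> [j||A' iA /(corr_summand (corr_sym cR) rUW)[A rA sA]].
- split; last exact: (rS j).2.
  exact: (corr_indecomposable cR (rS j).1 (iS j).1).
- by apply: (corr_noniso cR) nS => j; exact: (rS j).1.
- have [j iAj] := cS A (corr_indecomposable (corr_sym cR) rA iA) sA.
  exists j; apply: (corr_funl cR _ (rS j).1).
  exact: (corr_isol cR rA iAj).
Qed.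

(** * Linear algebra in arbitrary dimension *)

Section Kernel.
Variables (k : pzRingType) (U V : lmodType k) (f : {linear U -> V}).

Definition ker_pred : {pred U} := [pred x | f x == 0].

Fact ker_submod_closed : submod_closed ker_pred.
Proof.
split=> [|a x y]; rewrite !inE ?linear0 //.
by rewrite linearP => /eqP-> /eqP->; rewrite scaler0 addr0.
Qed.

HB.instance Definition _ := GRing.isSubmodClosed.Build k U ker_pred
  (GRing.submod_closed_semi ker_submod_closed).

Definition ker : Type := {x : U | x \in ker_pred}.

HB.instance Definition _ := SubChoice.on ker.
HB.instance Definition _ := [SubChoice_isSubLmodule of ker by <:].

(** This inclusion and ker_lift are locked: otherwise unification looks through the
    subtype and takes the sum of two elements of the kernel for their sum in U. *)
Definition ker_in (w : ker) : U := locked (val w).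

Fact ker_in_linear : linear ker_in.
Proof. by move=> a x y; rewrite /ker_in -!lock linearP. Qed.

HB.instance Definition _ :=
  GRing.isLinear.Build k ker U *:%R ker_in ker_in_linear.

Lemma ker_in_inj : injective ker_in.
Proof. by move=> x y; rewrite /ker_in -!lock; exact: val_inj. Qed.

Lemma ker_inP (x : ker) : f (ker_in x) = 0.
Proof. by rewrite /ker_in -lock; apply/eqP; exact: (valP x). Qed.

Lemma ker_ex x : f x = 0 -> exists w, ker_in w = x.
Proof.
move=> fx; have kx : x \in ker_pred by rewrite inE fx.
by exists (Sub x kx); rewrite /ker_in -lock.
Qed.

Section Lift.
Variables (W : lmodType k) (h : {linear W -> U}).
Hypothesis fh : forall w, f (h w) = 0.

Fact ker_lift_subproof w : h w \in ker_pred.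
Proof. by rewrite inE fh. Qed.

Definition ker_lift (w : W) : ker := locked (Sub (h w) (ker_lift_subproof w) : ker).

Lemma ker_liftE w : ker_in (ker_lift w) = h w.
Proof. by rewrite /ker_in /ker_lift -!lock. Qed.

Fact ker_lift_linear : linear ker_lift.
Proof. by move=> a x y; apply: ker_in_inj; rewrite ?linearP /= !ker_liftE linearP. Qed.

HB.instance Definition _ :=
  GRing.isLinear.Build k W ker *:%R ker_lift ker_lift_linear.

End Lift.

End Kernel.
Arguments ker_in {k U V f} w : simpl never.

Section Splitting.
Variable k : fieldType.
Implicit Types U V : lmodType k.
Local Open Scope classical_set_scope.

(** By Zorn, a subspace T maximal among those that meet the image of f
    trivially is a complement of that image. *)
Lemma linear_retraction U V (f : {linear U -> V}) : injective f ->
  exists r : {linear V -> U}, cancel f r.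
Proof.
move=> f_inj.
pose zero_adj (A : set V) : set V := [set t | A t \/ t = 0].
pose indep (A : set V) := (forall (a : k) x y,
    zero_adj A x -> zero_adj A y -> zero_adj A (a *: x + y)) /\
  (forall x, zero_adj A (f x) -> f x = 0).
have [F Find Ftot|T [[Tlin Tind] Tmax]] := @Zorn_bigcup V indep.
  split=> [a x y|x].
    case=> [[A FA Ax]|->]; case=> [[B FB By]|->].
    - have [AB|BA] := Ftot _ _ FA FB.
        have [+ _] := Find _ FB => /(_ a x y (or_introl (AB _ Ax)) (or_introl By)).
        by case=> [?|->]; [left; exists B|right].
      have [+ _] := Find _ FA => /(_ a x y (or_introl Ax) (or_introl (BA _ By))).
      by case=> [?|->]; [left; exists A|right].
    - have [+ _] := Find _ FA => /(_ a x 0 (or_introl Ax) (or_intror erefl)).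
      by case=> [?|->]; [left; exists A|right].
    - by rewrite scaler0 add0r; left; exists B.
    - by rewrite scaler0 addr0; right.
  case=> [[A FA Ax]|//].
  by have [_] := Find _ FA => /(_ x (or_introl Ax)).
(* If some u were outside im f + T, then T could be enlarged by the line of u. *)
have T0 : zero_adj T 0 by right.
have Tdec u : exists x, zero_adj T (u - f x).
  apply: contrapT => nu.
  pose B : set V := [set y | exists (a : k) t, zero_adj T t /\ y = a *: u + t].
  have B0 : zero_adj B `<=` B.
    by move=> y [//|->]; exists 0, 0; split=> //; rewrite scale0r addr0.
  apply: (Tmax B); first split.
  - by move=> t Tt; exists 0, t; split; [left|rewrite scale0r add0r].
  - move=> TB; apply: nu; exists 0; rewrite linear0 subr0; left; apply: TB.
    by exists 1, 0; split=> //; rewrite scale1r addr0.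
  split=> [a x y /B0[b [s [Ts ->]]] /B0[c [t [Tt ->]]]|x /B0[a [t [Tt]]]].
    left; exists (a * b + c), (a *: s + t); split; first exact: Tlin.
    by rewrite scalerDr scalerA scalerDl addrACA.
  have [->|a0] := eqVneq a 0; first by rewrite scale0r add0r => fx; apply: Tind; rewrite fx.
  move=> fx; case: nu; exists (a^-1 *: x).
  suff -> : u - f (a^-1 *: x) = - a^-1 *: t + 0 by apply: Tlin.
  rewrite linearZ /= fx scalerDr scalerA mulVf // scale1r opprD addrA subrr.
  by rewrite add0r addr0 scaleNr.
have [r rP] := choice Tdec.
have r_eq u x : zero_adj T (u - f x) -> r u = x.
  move=> Tux; apply/f_inj/eqP; rewrite -subr_eq0 -linearB /=.
  apply/eqP; apply: Tind; rewrite linearB /=.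
  suff -> : f (r u) - f x = -1 *: (u - f (r u)) + (u - f x) by apply: Tlin.
  by rewrite scaleN1r opprB addrA subrK.
have r_lin : linear r.
  move=> a x y; apply: r_eq; rewrite linearP /= opprD addrACA -scalerBr.
  exact: Tlin.
by exists (lin r_lin) => x; apply: r_eq; rewrite subrr.
Qed.

(** A section is a choice of preimages, corrected by a retraction onto the
    kernel so that it no longer depends on the choice. *)
Lemma linear_section U V (f : {linear U -> V}) : (forall y, exists x, f x = y) ->
  exists s : {linear V -> U}, cancel s f.
Proof.
move=> /choice[g fg]; have [r rK] := @linear_retraction _ _ (@ker_in _ _ _ f) (@ker_in_inj _ _ _ f).
have indep x x' : f x = f x' -> x - ker_in (r x) = x' - ker_in (r x').
  move=> e; have [|w wE] := @ker_ex _ _ _ f (x - x').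
    by rewrite linearB /= e subrr.
  have -> : x = ker_in w + x' by rewrite wE subrK.
  by rewrite linearD rK linearD opprD addrACA subrr add0r.
have s_lin : linear (fun y => g y - ker_in (r (g y))).
  move=> a y y'; rewrite (indep _ (a *: g y + g y')); last by rewrite linearP /= !fg.
  by rewrite 2!linearP /= opprD addrACA scalerBr.
by exists (lin s_lin) => y /=; rewrite linearB /= fg ker_inP subr0.
Qed.

Lemma linear_sep U V (x : U) (y : V) : x != 0 -> exists h : {linear U -> V}, h x = y.
Proof.
move=> x0.
have lx : linear (fun c : k^o => c *: x) by move=> a b c; rewrite scalerDl scalerA.
have [|r rK] := @linear_retraction _ _ (lin lx).
  by move=> a b /= /eqP; rewrite -subr_eq0 -scalerBl scaler_eq0 (negPf x0) orbF
    subr_eq0 => /eqP.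
have ly : linear (fun u => (r u : k) *: y).
  by move=> a u w; rewrite linearP /= scalerDl scalerA.
exists (lin ly) => /=.
by have /= := rK 1; rewrite scale1r => ->; rewrite scale1r.
Qed.

End Splitting.

Section Pairs.
Variables (k : pzRingType) (U V : lmodType k).

Fact fst_linear : linear (fun u : U * V => u.1). Proof. by []. Qed.

Fact snd_linear : linear (fun u : U * V => u.2). Proof. by []. Qed.

Fact inl_linear : linear (fun u : U => (u, 0) : U * V).
Proof. by move=> c u w; congr pair; rewrite /= scaler0 addr0. Qed.

Fact inr_linear : linear (fun w : V => (0, w) : U * V).
Proof. by move=> c u w; congr pair; rewrite /= scaler0 addr0. Qed.

Lemma sum_pair (I : finType) (F : I -> U * V) :
  \sum_i F i = (\sum_i (F i).1, \sum_i (F i).2).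
Proof. by apply: (big_rec3 (fun a b p => p = (a, b))) => // i a b p _ ->. Qed.

End Pairs.

Section FiniteGeneration.
Variable k : pzRingType.
Implicit Types U V : lmodType k.

Lemma fg_fin U (I : finType) (u : I -> U) :
  (forall x, exists c : I -> k, x = \sum_i c i *: u i) -> finitely_generated U.
Proof.
move=> uP; exists #|I|, (fun j => u (enum_val j)) => x.
have [c ->] := uP x; exists (fun j => c (enum_val j)).
by rewrite (reindex _ (onW_bij _ (enum_val_bij I))).
Qed.

Lemma fg_surj U V (f : {linear U -> V}) : (forall y, exists x, f x = y) ->
  finitely_generated U -> finitely_generated V.
Proof.
move=> f_surj [m [u uP]]; exists m, (fun j => f (u j)) => y.
have [x <-] := f_surj y; have [c ->] := uP x; exists c.
by rewrite linear_sum; apply: eq_bigr => i _; rewrite linearZ.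
Qed.

Lemma fg_iso U V : isomorphic U V -> finitely_generated U -> finitely_generated V.
Proof. by move=> [f [g _ gf]]; apply: (@fg_surj _ _ f) => y; exists (g y). Qed.

Lemma fg_prod U V : finitely_generated U -> finitely_generated V ->
  finitely_generated (U * V)%type.
Proof.
move=> [m [u uP]] [n [w wP]].
pose g (i : 'I_m + 'I_n) : U * V :=
  match i with inl i => (u i, 0) | inr j => (0, w j) end.
apply: (@fg_fin _ _ g) => -[x y]; have [c ->] := uP x; have [d ->] := wP y.
exists (fun i => match i with inl i => c i | inr j => d j end).
rewrite big_sumType /=.
rewrite !sum_pair; apply: (congr2 pair) => /=.
  by rewrite [X in _ + X]big1 ?addr0 // => i; rewrite scaler0.
by rewrite [X in X + _]big1 ?add0r // => i; rewrite scaler0.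
Qed.

Lemma fg_pair U V :
  finitely_generated (U * V)%type <-> finitely_generated U /\ finitely_generated V.
Proof.
split=> [UV|[fU fV]]; last exact: fg_prod.
split; first by apply: (fg_surj (f := lin (@fst_linear k U V))) UV => x; exists (x, 0).
by apply: (fg_surj (f := lin (@snd_linear k U V))) UV => y; exists (0, y).
Qed.

Lemma fg_ffun (I : finType) U : finitely_generated U ->
  finitely_generated {ffun I -> U}.
Proof.
move=> [m [u uP]].
pose g (p : I * 'I_m) : {ffun I -> U} := [ffun i => if i == p.1 then u p.2 else 0].
apply: (@fg_fin _ _ g) => x.
have /choice[c cP] i : exists c : 'I_m -> k, x i = \sum_(j < m) c j *: u j by exact: uP.
exists (fun p => c p.1 p.2); apply/ffunP => i; rewrite sum_ffunE.
rewrite cP (eq_bigr (fun p => if i == p.1 then c i p.2 *: u p.2 else 0)); last first.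
  by move=> [l j] _; rewrite !ffunE /=; case: eqP => [->|]; rewrite ?scaler0.
rewrite -(pair_bigA _ (fun l j => if i == l then c i j *: u j else 0)) /=.
by rewrite (bigD1 i) //= eqxx [X in _ + X]big1 ?addr0 // => l /negPf nl;
  rewrite eq_sym nl big1.
Qed.

End FiniteGeneration.

(** * Representations of a quiver and modules over its path algebra *)

Section Representations.
Variables (k : fieldType) (Q : quiver).
Local Notation L := (path_algebra k Q).
Local Notation monomial c p := (<< c *g p >> : L).

(** A representation is kept as its total space: rv x is the projection onto the
    component at the vertex x and ra a is the action of the arrow a, which kills
    the components other than the one at the source of a. This form avoids
    families of spaces indexed by vertices, hence transports along equalities of
    vertices, in particular between a quiver and its mutation. *)
Record rep := Rep {
  rsp : lmodType k;
  rv : vertex Q -> {linear rsp -> rsp};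
  ra : arrow Q -> {linear rsp -> rsp};
  rvv : forall x y u, rv x (rv y u) = if x == y then rv y u else 0;
  rv_sum : forall u, \sum_x rv x u = u;
  ra_source : forall a u, ra a (rv (source a) u) = ra a u;
  ra_target : forall a u, rv (target a) (ra a u) = ra a u
}.

Lemma rvK (r : rep) x (u : rsp r) : rv r x (rv r x u) = rv r x u.
Proof. by rewrite rvv eqxx. Qed.

Lemma rv_eq0 (r : rep) x y (u : rsp r) : x != y -> rv r x (rv r y u) = 0.
Proof. by rewrite rvv => /negPf->. Qed.

Section RepModule.
Variable r : rep.
Implicit Types (u w : rsp r) (p q : qpath Q) (f g : L).

Definition arrows_act (s : seq (arrow Q)) u := foldl (fun w a => ra r a w) u s.

Definition path_act p u := arrows_act (parrows p) (rv r (psource p) u).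

Fact arrows_act_linear s : linear (arrows_act s).
Proof.
by elim: s => [|a s IHs] // c u w; rewrite /arrows_act /= linearP; exact: IHs.
Qed.

HB.instance Definition _ s :=
  GRing.isLinear.Build k (rsp r) (rsp r) *:%R (arrows_act s) (arrows_act_linear s).

Fact path_act_linear p : linear (path_act p).
Proof. by move=> c u w; rewrite /path_act !linearP. Qed.

HB.instance Definition _ p :=
  GRing.isLinear.Build k (rsp r) (rsp r) *:%R (path_act p) (path_act_linear p).

Lemma arrows_act_target x s u : is_qpath x s -> rv r x u = u ->
  rv r (last x (map (@target Q) s)) (arrows_act s u) = arrows_act s u.
Proof.
elim: s x u => //= a s IHs x u /andP[_ ps] _.
by apply: IHs => //; exact: ra_target.
Qed.

Lemma path_act_target p u : rv r (ptarget p) (path_act p u) = path_act p u.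
Proof. by apply: arrows_act_target; [exact: (valP p)|exact: rvK]. Qed.

Lemma path_act_comp p q u :
  path_act p (path_act q u) = if pconcat q p is Some s then path_act s u else 0.
Proof.
rewrite {1}/path_act -path_act_target.
have [e|ne] := eqVneq (ptarget q) (psource p); last first.
  by rewrite pconcat_none // rv_eq0 ?linear0 // eq_sym.
have [s -> sE] := pconcat_some e; rewrite e rvK -e path_act_target.
by rewrite {2}/path_act /psource /parrows sE /= /arrows_act foldl_cat.
Qed.

Definition rep_act f u := \sum_(p <- msupp f) f@_p *: path_act p u.

(** The sum may run over any finite set of paths containing the support, which
    is what makes the action additive. *)
Lemma rep_actw (d : {fset qpath Q}) f u : (msupp f `<=` d)%fset ->
  rep_act f u = \sum_(p <- d) f@_p *: path_act p u.
Proof.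
move=> le; rewrite /rep_act (big_fset_incl _ le) //= => p _ /mcoeff_outdom ->.
by rewrite scale0r.
Qed.

Fact rep_actDl u : {morph rep_act^~ u : f g / f + g}.
Proof.
move=> f g; rewrite (rep_actw _ (msuppD_le f g)).
rewrite (rep_actw _ (fsubsetUl (msupp f) (msupp g))).
rewrite (rep_actw _ (fsubsetUr (msupp f) (msupp g))) -big_split.
by apply: eq_bigr => p _; rewrite mcoeffD scalerDl.
Qed.

Fact rep_actDr : right_distributive rep_act +%R.
Proof.
move=> f u w; rewrite /rep_act -big_split; apply: eq_bigr => p _ /=.
by rewrite linearD scalerDr.
Qed.

Lemma rep_act0 u : rep_act 0 u = 0.
Proof. by rewrite /rep_act msupp0 big_seq_fset0. Qed.

Lemma rep_actU c p u : rep_act << c *g p >> u = c *: path_act p u.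
Proof. by rewrite (rep_actw _ msuppU_le) big_seq_fset1 mcoeffUU. Qed.

Lemma rep_act_suml I (s : seq I) (F : I -> L) u :
  rep_act (\sum_(i <- s) F i) u = \sum_(i <- s) rep_act (F i) u.
Proof. exact: (big_morph (rep_act^~ u) (rep_actDl u) (rep_act0 u)). Qed.

Lemma rep_act_sumr I (s : seq I) (F : I -> rsp r) f :
  rep_act f (\sum_(i <- s) F i) = \sum_(i <- s) rep_act f (F i).
Proof.
apply: (big_morph (rep_act f) (rep_actDr f)).
by apply: (@addrI _ (rep_act f 0)); rewrite -rep_actDr !addr0.
Qed.

Fact rep_actA f g u : rep_act f (rep_act g u) = rep_act (f * g) u.
Proof.
rewrite [f in RHS]path_algebraE [f in LHS]path_algebraE.
rewrite [X in _ = rep_act X u]path_mul_suml !rep_act_suml.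
apply: eq_bigr => p _.
rewrite [g in RHS]path_algebraE [g in LHS]path_algebraE.
rewrite path_mul_sumr !rep_act_suml rep_act_sumr.
apply: eq_bigr => q _; rewrite path_mulUU !rep_actU linearZ /= scalerA.
rewrite path_act_comp; case: (pconcat q p) => [s|] /=; first by rewrite rep_actU.
by rewrite rep_act0 scaler0.
Qed.

Lemma rep_act_lazy x u : rep_act << 1 *g lazy_path x >> u = rv r x u.
Proof. by rewrite rep_actU scale1r. Qed.

Fact rep_act1 : left_id 1 rep_act.
Proof.
move=> u; rewrite [LHS]rep_act_suml -[RHS]rv_sum.
by apply: eq_bigr => x _; rewrite rep_act_lazy.
Qed.

Definition rep_space : Type := rsp r.

HB.instance Definition _ := GRing.Zmodule.on rep_space.
HB.instance Definition _ := GRing.Zmodule_isLmodule.Build L rep_space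
  rep_actA rep_act1 rep_actDr rep_actDl.

Definition rep_mod : lmodType L := rep_space.

End RepModule.

Definition arrow_path_subproof (a : arrow Q) :
  is_qpath (source a, [:: a]).1 (source a, [:: a]).2.
Proof. by rewrite /= eqxx. Qed.

Definition arrow_path a : qpath Q := QPath (arrow_path_subproof a).

Lemma rep_act_arrow (r : rep) a (u : rsp r) :
  rep_act << 1 *g arrow_path a >> u = ra r a u.
Proof. by rewrite rep_actU scale1r /path_act /= ra_source. Qed.

(** The image of c in the path algebra; k acts on modules through it. *)
Definition path_scalar (c : k) : L := \sum_x monomial c (lazy_path x).

Lemma path_scalarMl c d p : path_scalar c * monomial d p = monomial (c * d) p.
Proof.
rewrite mulr_suml (bigD1 (ptarget p)) //= [X in X + _]path_mulUU.
rewrite pconcat_lazyr eqxx big1 ?addr0 // => x /negPf nx.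
by rewrite [LHS]path_mulUU pconcat_lazyr nx.
Qed.

Lemma path_scalarMr c d p : monomial d p * path_scalar c = monomial (c * d) p.
Proof.
rewrite mulr_sumr (bigD1 (psource p)) //= [X in X + _]path_mulUU.
rewrite pconcat_lazyl eqxx big1 ?addr0 1?mulrC // => x /negPf nx.
by rewrite [LHS]path_mulUU pconcat_lazyl nx.
Qed.

Lemma path_scalarM c d : path_scalar c * path_scalar d = path_scalar (c * d).
Proof. by rewrite mulr_sumr; apply: eq_bigr => x _; rewrite path_scalarMl. Qed.

Lemma path_scalarD c d : path_scalar (c + d) = path_scalar c + path_scalar d.
Proof. by rewrite -big_split; apply: eq_bigr => x _ /=; rewrite monalgUD. Qed.

Lemma rep_act_path_scalar (r : rep) c (u : rsp r) : rep_act (path_scalar c) u = c *: u.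
Proof.
rewrite rep_act_suml -[u in RHS](rv_sum u) scaler_sumr.
by apply: eq_bigr => x _; rewrite rep_actU.
Qed.

Section ModuleRep.
Variable U : lmodType L.

Definition restr : Type := U.

HB.instance Definition _ := GRing.Zmodule.on restr.

Definition restr_scale (c : k) (u : restr) : restr := path_scalar c *: (u : U).

Fact restr_scaleA c d u : restr_scale c (restr_scale d u) = restr_scale (c * d) u.
Proof. by rewrite /restr_scale scalerA path_scalarM. Qed.

Fact restr_scale1 : left_id 1 restr_scale.
Proof. by move=> u; exact: scale1r. Qed.

Fact restr_scaleDr : right_distributive restr_scale +%R.
Proof. by move=> c u w; rewrite /restr_scale scalerDr. Qed.

Fact restr_scaleDl u : {morph restr_scale^~ u : c d / c + d}.
Proof. by move=> c d; rewrite /restr_scale path_scalarD scalerDl. Qed.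

HB.instance Definition _ := GRing.Zmodule_isLmodule.Build k restr
  restr_scaleA restr_scale1 restr_scaleDr restr_scaleDl.

Definition path_op (p : qpath Q) (u : restr) : restr :=
  (<< 1 *g p >> : L) *: (u : U).

Fact path_op_linear p : linear (path_op p).
Proof.
move=> c u w; rewrite /path_op scalerDr; congr (_ + _).
rewrite [c *: u]/(restr_scale c u) [c *: _]/(restr_scale c _) /restr_scale.
by rewrite !scalerA path_scalarMl path_scalarMr.
Qed.

HB.instance Definition _ p :=
  GRing.isLinear.Build k restr restr *:%R (path_op p) (path_op_linear p).

Lemma path_op_comp p q u :
  path_op p (path_op q u) = if pconcat q p is Some s then path_op s u else 0.
Proof.
rewrite /path_op scalerA [_ * _]path_mulUU mulr1.
by case: (pconcat q p) => [s|] //=; rewrite scale0r.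
Qed.

Fact mod_rvv x y u : path_op (lazy_path x) (path_op (lazy_path y) u) =
  if x == y then path_op (lazy_path y) u else 0.
Proof. by rewrite path_op_comp pconcat_lazyr; case: eqP. Qed.

Fact mod_rv_sum u : \sum_x path_op (lazy_path x) u = u.
Proof.
transitivity ((1 : L) *: (u : U)); last exact: scale1r.
have -> : (1 : L) = \sum_x monomial 1 (lazy_path x) by [].
by rewrite scaler_suml.
Qed.

Fact mod_ra_source a u :
  path_op (arrow_path a) (path_op (lazy_path (source a)) u) =
  path_op (arrow_path a) u.
Proof. by rewrite path_op_comp pconcat_lazyl eqxx. Qed.

Fact mod_ra_target a u :
  path_op (lazy_path (target a)) (path_op (arrow_path a) u) =
  path_op (arrow_path a) u.
Proof. by rewrite path_op_comp pconcat_lazyr eqxx. Qed.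

Definition mod_rep : rep := @Rep restr (fun x => path_op (lazy_path x))
  (fun a => path_op (arrow_path a)) mod_rvv mod_rv_sum mod_ra_source mod_ra_target.

Lemma path_act_mod_rep p (u : restr) : @path_act mod_rep p u = path_op p u.
Proof.
case: p => -[x s] ps; elim/last_ind: s ps => [|s a IHs] ps.
  by rewrite (_ : QPath ps = lazy_path x) //; apply: val_inj.
have : is_qpath x (s ++ [:: a]) by rewrite cats1.
rewrite is_qpath_cat => /andP[ps' /andP[/eqP ea _]].
have -> : path_act (r := mod_rep) (QPath ps) u =
    path_op (arrow_path a) (path_act (r := mod_rep) (@QPath Q (x, s) ps') u).
  by rewrite /path_act /arrows_act /= foldl_rcons.
rewrite IHs path_op_comp.
suff /pconcatP -> : ptarget (@QPath Q (x, s) ps') = psource (arrow_path a) /\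
    val (QPath ps) = (x, s ++ [:: a]) by [].
by rewrite cats1.
Qed.

Lemma iso_mod_rep : isomorphic U (rep_mod mod_rep).
Proof.
have idlin : linear (fun u : U => (u : rep_mod mod_rep)).
  move=> f u w; congr (_ + _); rewrite [RHS]/(rep_act _ _).
  rewrite {1}[f]path_algebraE [LHS]scaler_suml; apply: eq_bigr => p _.
  rewrite path_act_mod_rep -[X in << X *g _ >>]mulr1 -path_scalarMl.
  by rewrite -[LHS]scalerA.
by exists (lin idlin); exists id.
Qed.

End ModuleRep.

Definition rhom (r r' : rep) (h : {linear rsp r -> rsp r'}) : Prop :=
  (forall x u, h (rv r x u) = rv r' x (h u)) /\
  (forall a u, h (ra r a u) = ra r' a (h u)).

Lemma rhom_linear (r r' : rep) (h : {linear rsp r -> rsp r'}) : rhom h ->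
  linear (h : rep_mod r -> rep_mod r').
Proof.
move=> [hv ha] f u w; rewrite linearD; congr (_ + _).
rewrite [LHS]linear_sum; apply: eq_bigr => p _; rewrite linearZ /=.
suff -> : h (path_act p u) = path_act p (h u) by [].
rewrite /path_act -hv; elim: (parrows p) (rv r _ u) => //= a s IHs y.
by rewrite IHs ha.
Qed.

(** The scalars, the lazy paths and the arrows act through elements of the path
    algebra, so a module morphism commutes with all three. *)
Lemma linear_rhom (r r' : rep) (g : {linear rep_mod r -> rep_mod r'}) :
  exists2 h : {linear rsp r -> rsp r'}, rhom h & forall u, h u = g u.
Proof.
have gact f (u : rsp r) : g (rep_act f u) = rep_act f (g u : rsp r').
  exact: linearZ.
have glin : linear (g : rsp r -> rsp r').
  move=> c u w; rewrite -!rep_act_path_scalar [LHS]linearD; congr (_ + _).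
  by rewrite -gact.
exists (lin glin) => //; split=> [x|a] u /=.
  by rewrite -!rep_act_lazy gact.
by rewrite -!rep_act_arrow gact.
Qed.

End Representations.

(** * Sums, finite dimension and rigidity of representations *)

Section RepTheory.
Variables (k : fieldType) (Q : quiver).
Local Notation L := (path_algebra k Q).
Local Notation rep := (rep k Q).
Implicit Types r : rep.

Lemma rep_isoP r r' : isomorphic (rep_mod r) (rep_mod r') <->
  exists (f : {linear rsp r -> rsp r'}) (g : {linear rsp r' -> rsp r}),
    [/\ rhom f, rhom g, cancel f g & cancel g f].
Proof.
split=> [/isomorphicP[f [g [fg gf]]]|[f [g [hf hg fg gf]]]].
  have [f' hf fE] := linear_rhom f; have [g' hg gE] := linear_rhom g.
  by exists f', g'; split=> // u; rewrite fE gE.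
by exists (lin (rhom_linear hf)); exists g.
Qed.

Section Sum.
Variables r r' : rep.

Fact rsum_rv_linear x :
  linear (fun u : rsp r * rsp r' => (rv r x u.1, rv r' x u.2)).
Proof. by move=> c u w; rewrite !linearP. Qed.

Fact rsum_ra_linear a :
  linear (fun u : rsp r * rsp r' => (ra r a u.1, ra r' a u.2)).
Proof. by move=> c u w; rewrite !linearP. Qed.

Program Definition rsum : rep := @Rep k Q (rsp r * rsp r')%type
  (fun x => lin (rsum_rv_linear x)) (fun a => lin (rsum_ra_linear a)) _ _ _ _.
Next Obligation. by rewrite !rvv; case: eqP. Qed.
Next Obligation. by rewrite sum_pair /= !rv_sum. Qed.
Next Obligation. by rewrite !ra_source. Qed.
Next Obligation. by rewrite !ra_target. Qed.

Definition rfst : {linear rsp rsum -> rsp r} := lin (@fst_linear k (rsp r) (rsp r')).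
Definition rsnd : {linear rsp rsum -> rsp r'} := lin (@snd_linear k (rsp r) (rsp r')).
Definition rinl : {linear rsp r -> rsp rsum} := lin (@inl_linear k (rsp r) (rsp r')).
Definition rinr : {linear rsp r' -> rsp rsum} := lin (@inr_linear k (rsp r) (rsp r')).

Lemma rfst_rhom : rhom rfst. Proof. by []. Qed.
Lemma rsnd_rhom : rhom rsnd. Proof. by []. Qed.
Lemma rinl_rhom : rhom rinl.
Proof. by split=> [x|a] u; rewrite /= linear0. Qed.
Lemma rinr_rhom : rhom rinr.
Proof. by split=> [x|a] u; rewrite /= linear0. Qed.

Lemma rsum_iso : isomorphic (dsum (rep_mod r) (rep_mod r')) (rep_mod rsum).
Proof.
apply: iso_sym.
have lid : linear (fun u : rep_mod rsum => (u.1, u.2) : dsum (rep_mod r) (rep_mod r')).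
  move=> f u w; congr pair; first exact: (rhom_linear rfst_rhom).
  exact: (rhom_linear rsnd_rhom).
by exists (lin lid); exists (fun u => (u.1, u.2)) => -[].
Qed.

End Sum.

Section FiniteDimension.
Hypothesis hQ : acyclic Q.

(** A path that meets its starting vertex again contains a cycle. *)
Lemma acyclic_uniq x s : is_qpath x s -> uniq (x :: map (@target Q) s).
Proof.
elim: s x => // a s IHs x pas; have /andP[_ ps] := pas.
rewrite cons_uniq IHs // andbT; apply/negP => xin.
set l := map _ _ in xin; set i := index x l.
have := pas; rewrite -[a :: s](cat_take_drop i.+1) is_qpath_cat => /andP[pt _].
have e : x = last x (map (@target Q) (take i.+1 (a :: s))).
  by rewrite map_take -/l (take_nth x) ?index_mem // last_rcons nth_index.
by have := hQ (p := @QPath Q (x, take i.+1 (a :: s)) pt) e.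
Qed.

Lemma acyclic_paths : exists d : {fset qpath Q}, forall p, p \in d.
Proof.
pose n := #|vertex Q|.
pose paths := pmap (fun y : vertex Q * n.-bseq (arrow Q) =>
  insub (y.1, val y.2) : option (qpath Q)) (enum {: vertex Q * n.-bseq (arrow Q)}).
exists [fset p in paths]%fset => p; rewrite inE /= mem_pmap.
have /card_uniqP := acyclic_uniq (valP p); rewrite /= size_map => sz.
have le : (size (parrows p) <= n)%N by rewrite ltnW // -sz max_card.
apply/mapP; exists (psource p, Bseq le); first by rewrite mem_enum.
by rewrite /= -surjective_pairing valK.
Qed.

(** Only finitely many paths exist, so finitely many generators of the module
    have finitely many multiples by paths, and these span the space. *)
Lemma fg_rep r : finitely_generated (rep_mod r) <-> finitely_generated (rsp r).
Proof.
split=> -[m [u uP]].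
  have [d dP] := acyclic_paths.
  apply: (@fg_fin _ _ _ (fun y : 'I_m * d => path_act (val y.2) (u y.1))) => x.
  have [c ->] := uP x; exists (fun y => (c y.1)@_(val y.2)).
  rewrite -(pair_bigA _ (fun i p => (c i)@_(val p) *: path_act (val p) (u i))) /=.
  apply: eq_bigr => i _; rewrite [LHS](@rep_actw _ _ _ d) ?big_seq_fsetE //.
  by apply/fsubsetP => p _; exact: dP.
exists m, u => x; have [c ->] := uP x; exists (fun i => path_scalar Q (c i)).
by apply: eq_bigr => i _; rewrite [RHS]rep_act_path_scalar.
Qed.

End FiniteDimension.

Definition graded r r' (h : rsp r -> rsp r') : Prop :=
  forall x u, h (rv r x u) = rv r' x (h u).

(** Over a hereditary algebra the first extension group is the cokernel of the map
    that sends a family of endomorphisms of the components to its commutators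
    with the arrows. The next three definitions describe that presentation for
    self-extensions. *)
Definition cocycle r (theta : arrow Q -> {linear rsp r -> rsp r}) : Prop :=
  (forall a u, theta a (rv r (source a) u) = theta a u) /\
  (forall a u, rv r (target a) (theta a u) = theta a u).

Definition bounds r (theta : arrow Q -> {linear rsp r -> rsp r})
    (b : {linear rsp r -> rsp r}) : Prop :=
  graded b /\ forall a u, theta a u = ra r a (b u) - b (ra r a u).

Definition cocycle_trivial r : Prop :=
  forall theta : arrow Q -> {linear rsp r -> rsp r}, cocycle theta ->
  exists b, bounds theta b.

Section TwistedSum.
Variables (r : rep) (theta : arrow Q -> {linear rsp r -> rsp r}).
Hypothesis theta_source : forall a u, theta a (rv r (source a) u) = theta a u.
Hypothesis theta_target : forall a u, rv r (target a) (theta a u) = theta a u.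

(** The self-extension of r with class theta: two copies of r, on which each
    arrow also acts by theta from the first copy to the second. *)
Fact twist_ra_linear a :
  linear (fun u : rsp r * rsp r => (ra r a u.1, ra r a u.2 + theta a u.1)).
Proof.
move=> c u w; congr pair; rewrite /=; first exact: linearP.
by rewrite 2!linearP scalerDr addrACA.
Qed.

Program Definition twist : rep := @Rep k Q (rsp r * rsp r)%type
  (fun x => lin (rsum_rv_linear (r' := r) x)) (fun a => lin (twist_ra_linear a)) _ _ _ _.
Next Obligation. by rewrite !rvv; case: eqP. Qed.
Next Obligation. by rewrite sum_pair /= !rv_sum. Qed.
Next Obligation. by rewrite !ra_source theta_source. Qed.
Next Obligation. by rewrite linearD /= !ra_target theta_target. Qed.

Definition twist_in : {linear rsp r -> rsp twist} :=
  lin (@inr_linear k (rsp r) (rsp r)).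
Definition twist_out : {linear rsp twist -> rsp r} :=
  lin (@fst_linear k (rsp r) (rsp r)).

Lemma twist_in_rhom : rhom twist_in.
Proof. by split=> [x|a] u; rewrite /= !linear0 ?addr0. Qed.

Lemma twist_out_rhom : rhom twist_out. Proof. by []. Qed.

Program Definition twist_ext : extension (rep_mod r) (rep_mod r) :=
  @Extension _ _ _ (rep_mod twist) (lin (rhom_linear twist_in_rhom))
    (lin (rhom_linear twist_out_rhom)) _ _ _.
Next Obligation. by move=> u w []. Qed.
Next Obligation. by exists (x, 0). Qed.
Next Obligation.
split=> [|[w <-]//]; case: y => u w /= ->.
by exists w.
Qed.

End TwistedSum.

(** An equivalence of the twisted sum with the direct sum is unitriangular; its
    corner bounds theta. *)
Lemma rigid_cocycle r : rigid (rep_mod r) -> cocycle_trivial r.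
Proof.
move=> rr theta [theta_s theta_t].
have [f [_ f_in _]] := rr (twist_ext theta_s theta_t).
have lsnd : linear (fun y : rep_mod (twist theta_s theta_t) => (f y).2).
  by move=> c y z; rewrite linearP.
have [h [hv ha] hE] := linear_rhom (lin lsnd).
have h_in z : h (0, z) = z by rewrite hE /= [f _](f_in z).
have blin : linear (fun u : rsp r => h (u, 0)).
  by move=> c u w; rewrite -linearP /=; congr (h (_, _)); rewrite /= scaler0 addr0.
have hD u z : h (u, z) = h (u, 0) + z.
  by rewrite -[in RHS](h_in z) -linearD; congr (h (_, _)); rewrite /= ?addr0 ?add0r.
exists (lin blin); split=> [x|a] u /=.
  by rewrite -hv /= linear0.
by rewrite -ha /= linear0 add0r [h (_, theta a u)]hD addrAC subrr add0r.
Qed.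

(** A k-linear section of the extension can be made to respect the vertices;
    its failure to commute with the arrows is then a cocycle, and a cochain that
    bounds it corrects the section. *)
Lemma rhom_section r s (i : {linear rsp r -> rsp s}) (o : {linear rsp s -> rsp r}) :
    cocycle_trivial r -> rhom i -> rhom o ->
    injective i -> (forall u, exists y, o y = u) ->
    (forall y, o y = 0 <-> exists z, i z = y) ->
  exists2 t : {linear rsp r -> rsp s}, rhom t & cancel t o.
Proof.
move=> triv [iv ia] [ov oa] i_inj o_surj exa.
have [t0 t0K] := linear_section o_surj; have [q qK] := linear_retraction i_inj.
have iq y : o y = 0 -> i (q y) = y by move=> /exa[z <-]; rewrite qK.
pose t1 u := \sum_x rv s x (t0 (rv r x u)).
have t1_lin : linear t1.
  move=> c u w; rewrite /t1 scaler_sumr -big_split; apply: eq_bigr => x _ /=.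
  by rewrite !linearP.
have t1K u : o (t1 u) = u.
  rewrite linear_sum -[RHS](rv_sum u); apply: eq_bigr => x _ /=.
  by rewrite ov t0K rvK.
have t1v x u : t1 (rv r x u) = rv s x (t1 u).
  rewrite /t1 linear_sum (bigD1 x) //= [in RHS](bigD1 x) //= !rvK.
  congr (_ + _); rewrite big1 => [|y yx]; last by rewrite rv_eq0 // !linear0.
  by rewrite big1 // => y yx; rewrite rv_eq0 // eq_sym.
pose d a u := ra s a (t1 u) - t1 (ra r a u).
have od a u : o (d a u) = 0 by rewrite /d linearB /= oa !t1K subrr.
have d_lin a : linear (fun u => q (d a u)).
  move=> c u w; rewrite -linearP; congr (q _).
  by rewrite /d (linearP (ra r a)) !t1_lin linearP scalerBr opprD addrACA.
have [|b [bv bE]] := triv (fun a => lin (d_lin a)).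
  split=> a u /=; first by rewrite /d t1v !ra_source.
  apply: i_inj; rewrite iv !iq //.
  by rewrite /d linearB /= ra_target -t1v ra_target.
have t_lin : linear (fun u => t1 u - i (b u)).
  move=> c u w; rewrite t1_lin (linearP b) (linearP i) scalerBr opprD.
  by rewrite addrACA.
exists (lin t_lin) => [|u] /=; last first.
  by rewrite linearB /= t1K (exa _).2 ?subr0 //; exists (b u).
split=> [x|a] u /=; first by rewrite t1v bv iv linearB.
have /(congr1 i) := bE a u; rewrite /= iq // linearB /= ia /d => e.
rewrite linearB /=.
have -> : ra s a (t1 u) = ra s a (i (b u)) - i (b (ra r a u)) + t1 (ra r a u).
  by rewrite -e subrK.
by rewrite addrAC [_ - i _ - _]addrAC subrr add0r addrC.
Qed.

(** An L-linear section of the projection splits the extension. *)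
Lemma cocycle_rigid r : cocycle_trivial r -> rigid (rep_mod r).
Proof.
move=> triv e; set E := ext_mod e.
have /isomorphicP[f [g [fg gf]]] := iso_mod_rep E.
have [i hi iE] := linear_rhom (f \o ext_in e).
have [o ho oE] := linear_rhom (ext_out e \o g).
have [|u|y|t ht tK] := rhom_section triv hi ho.
- by move=> u w; rewrite !iE /= => /(can_inj fg)/ext_in_inj.
- by have [y <-] := ext_out_surj e u; exists (f y); rewrite oE /= fg.
- rewrite oE /=; split=> [oy|[z <-]].
    have [z zE] := (ext_exact (g y)).1 oy; exists z; by rewrite iE /= zE gf.
  by apply: (ext_exact (g (i z))).2; exists z; rewrite iE /= fg.
have oin z : ext_out e (ext_in e z) = 0 by apply: (ext_exact (ext_in e z)).2; exists z.
have ot u : ext_out e (g (t u)) = u by have := oE (t u); rewrite tK /=.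
have p_lin : linear (fun y : dsum (rep_mod r) (rep_mod r) =>
    g (t y.1) + ext_in e y.2).
  move=> c y z; rewrite (rhom_linear ht) !linearP scalerDr.
  by rewrite addrACA.
pose p := lin p_lin.
have out_p y : ext_out e (p y) = y.1 by rewrite /= linearD ot oin addr0.
have p_surj y : exists z, p z = y.
  have [|z zE] := (ext_exact (y - g (t (ext_out e y)))).1.
    by rewrite linearB /= ot subrr.
  by exists (ext_out e y, z); rewrite /= zE addrC subrK.
have p_inj : injective p.
  move=> [u z] [u' z'] epz; have /= uu' := congr1 (ext_out e) epz.
  move: epz; rewrite /= !linearD !oin !addr0 !ot in uu' *.
  by rewrite uu' => /addrI/ext_in_inj ->.
have [q qK] := choice p_surj.
have pK : cancel p q by move=> y; apply: p_inj; rewrite qK.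
exists (lin (can_linear pK qK)); split=> [|z|y] /=.
- by exists p.
- by apply: p_inj; rewrite qK /= linear0 linear0 add0r.
- by rewrite -[in RHS](qK y) out_p.
Qed.

End RepTheory.

(** * The space of incoming vectors at a vertex *)

Section Star.
Variables (k : fieldType) (Q : quiver) (v : vertex Q).
Local Notation rep := (rep k Q).

Section Incoming.
Variable X : rep.

(** The sum over the arrows a that end at v of the components of X at the source
    of a, realised as the functions on arrows fixed by the projections onto these
    components. *)
Fact in_defect_linear : linear (fun m : {ffun arrow Q -> rsp X} =>
  [ffun a => m a - (if target a == v then rv X (source a) (m a) else 0)]).
Proof.
move=> c m n; apply/ffunP => a; rewrite !ffunE; case: eqP => _; last by rewrite !subr0.
by rewrite linearP scalerBr opprD addrACA.
Qed.

Definition incoming : lmodType k := ker (lin in_defect_linear).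

Definition in_proj a (m : incoming) : rsp X := ker_in m a.

Fact in_proj_linear a : linear (in_proj a).
Proof. by move=> c m n; rewrite /in_proj linearP !ffunE. Qed.

HB.instance Definition _ a :=
  GRing.isLinear.Build k incoming (rsp X) *:%R (in_proj a) (in_proj_linear a).

Lemma in_proj_fix a m :
  in_proj a m = if target a == v then rv X (source a) (in_proj a m) else 0.
Proof.
have /ffunP/(_ a) := ker_inP m; rewrite /= !ffunE => /eqP.
by rewrite subr_eq0 => /eqP.
Qed.

Lemma in_proj_source a m : rv X (source a) (in_proj a m) = in_proj a m.
Proof. by rewrite in_proj_fix; case: eqP => _; rewrite ?rvK ?linear0. Qed.

Lemma in_proj0 a m : target a != v -> in_proj a m = 0.
Proof. by rewrite in_proj_fix => /negPf->. Qed.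

Lemma incoming_ext m n : (forall a, in_proj a m = in_proj a n) -> m = n.
Proof. by move=> e; apply: ker_in_inj; apply/ffunP => a; exact: e. Qed.

Fact in_inj_fun_linear a : linear (fun u : rsp X =>
  [ffun b => if (b == a) && (target a == v) then rv X (source a) u else 0]).
Proof.
move=> c u w; apply/ffunP => b; rewrite !ffunE.
by case: ifP => _; rewrite ?linearP // scaler0 addr0.
Qed.

Fact in_inj_subproof a u : lin in_defect_linear (lin (in_inj_fun_linear a) u) = 0.
Proof.
apply/ffunP => b; rewrite /= !ffunE; case: (eqVneq b a) => [->|_] /=.
  by case: eqP => _; rewrite ?rvK subrr.
by rewrite linear0 if_same subrr.
Qed.

Definition in_inj a (u : rsp X) : incoming := ker_lift (in_inj_subproof a) u.

Fact in_inj_linear a : linear (in_inj a).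
Proof. by move=> c u w; rewrite /in_inj linearP. Qed.

HB.instance Definition _ a :=
  GRing.isLinear.Build k (rsp X) incoming *:%R (in_inj a) (in_inj_linear a).

Lemma in_proj_inj b a u : in_proj b (in_inj a u) =
  if (b == a) && (target a == v) then rv X (source a) u else 0.
Proof. by rewrite /in_proj ker_liftE /= ffunE. Qed.

Lemma incoming_sum m : m = \sum_a in_inj a (in_proj a m).
Proof.
apply: incoming_ext => b; rewrite linear_sum (bigD1 b) //= big1 => [|a ab].
  by rewrite addr0 in_proj_inj eqxx -in_proj_fix.
by rewrite in_proj_inj eq_sym (negPf ab).
Qed.

Lemma incoming_hom_ext (V : lmodType k) (f g : {linear incoming -> V}) :
  (forall a u, f (in_inj a u) = g (in_inj a u)) -> f =1 g.
Proof.
move=> fg m; rewrite [m]incoming_sum !linear_sum; apply: eq_bigr => a _ /=.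
exact: fg.
Qed.

Lemma in_inj_source a u : in_inj a (rv X (source a) u) = in_inj a u.
Proof. by apply: incoming_ext => b; rewrite !in_proj_inj rvK. Qed.

Lemma in_inj0 a u : target a != v -> in_inj a u = 0.
Proof.
move=> /negPf ta; apply: incoming_ext => b.
by rewrite in_proj_inj ta andbF linear0.
Qed.

Lemma fg_incoming : finitely_generated (rsp X) -> finitely_generated incoming.
Proof.
move=> /(@fg_ffun _ (arrow Q)) fgX.
have slin : linear (fun m : {ffun arrow Q -> rsp X} => \sum_a in_inj a (m a)).
  move=> c m n; rewrite scaler_sumr -big_split; apply: eq_bigr => a _ /=.
  by rewrite !ffunE linearP.
apply: (@fg_surj _ _ _ (lin slin)) fgX => m.
exists (ker_in m); exact/esym/incoming_sum.
Qed.

End Incoming.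

Section IncomingMap.
Variables (X X' : rep) (h : {linear rsp X -> rsp X'}).

Definition in_map (m : incoming X) : incoming X' :=
  \sum_a in_inj a (h (in_proj a m)).

Fact in_map_linear : linear in_map.
Proof.
move=> c m n; rewrite /in_map scaler_sumr -big_split; apply: eq_bigr => a _ /=.
by rewrite !linearP.
Qed.

HB.instance Definition _ :=
  GRing.isLinear.Build k (incoming X) (incoming X') *:%R in_map in_map_linear.

Hypothesis hg : graded h.

Lemma in_proj_map a m : in_proj a (in_map m) = h (in_proj a m).
Proof.
rewrite linear_sum (bigD1 a) //= big1 => [|b ba].
  by rewrite addr0 in_proj_inj eqxx /= -hg in_proj_source in_proj_fix;
    case: eqP => _; rewrite ?linear0.
by rewrite in_proj_inj eq_sym (negPf ba).
Qed.

Lemma in_map_inj a u : in_map (in_inj a u) = in_inj a (h u).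
Proof.
apply: incoming_ext => b; rewrite in_proj_map !in_proj_inj -hg.
by case: ifP => _; rewrite ?linear0.
Qed.

End IncomingMap.

Lemma in_mapK (X X' : rep) (h : {linear rsp X -> rsp X'})
    (h' : {linear rsp X' -> rsp X}) :
  graded h -> graded h' -> cancel h h' -> cancel (in_map h) (in_map h').
Proof.
by move=> gh gh' hK m; apply: incoming_ext => a; rewrite !in_proj_map ?hK.
Qed.

(** Representations of the quiver with v removed. *)
Record brep := BRep { brep_rep :> rep; brep_v : forall u, rv brep_rep v u = 0 }.

Lemma brep_ra (X : brep) a (u : rsp X) : target a = v -> ra X a u = 0.
Proof. by move=> ta; rewrite -ra_target ta brep_v. Qed.

Section Pairs.
Variables (X : brep) (V : lmodType k).

Fact pair_rv_linear x :
  linear (fun u : rsp X * V => (rv X x u.1, if x == v then u.2 else 0)).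
Proof.
move=> c u w; congr pair; rewrite /=; first exact: linearP.
by case: eqP => _; rewrite ?scaler0 ?addr0.
Qed.

Definition pair_rv x : {linear (rsp X * V)%type -> (rsp X * V)%type} := lin (pair_rv_linear x).

Fact pair_rvv x y u :
  pair_rv x (pair_rv y u) = if x == y then pair_rv y u else 0.
Proof.
rewrite /= rvv; case: (eqVneq x y) => [->|xy] //=.
  by case: eqP => [->|].
by case: (eqVneq x v) xy => [->|_ //]; rewrite eq_sym => /negPf->.
Qed.

Fact pair_rv_sum u : \sum_x pair_rv x u = u.
Proof.
rewrite sum_pair /= rv_sum (bigD1 v) //= eqxx big1 ?addr0 => [|x /negPf->] //.
by case: u.
Qed.

End Pairs.

(** X has no component at v, so V is the whole component at v of X * V and a
    graded map cannot mix the two factors. *)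
Lemma pair_graded (X X' : brep) (V V' : lmodType k)
    (h : {linear (rsp X * V)%type -> (rsp X' * V')%type}) :
    (forall x u, h (pair_rv X V x u) = pair_rv X' V' x (h u)) ->
  exists (al : {linear rsp X -> rsp X'}) (be : {linear V -> V'}),
    graded al /\ forall p q, h (p, q) = (al p, be q).
Proof.
move=> hg.
have lal : linear (fun p => (h (p, 0)).1).
  move=> c p p'; have -> : (c *: p + p', 0) = c *: (p, 0) + (p', 0) :> rsp X * V.
    exact: inl_linear.
  by rewrite linearP.
have lbe : linear (fun q => (h (0, q)).2).
  move=> c q q'; have -> : (0, c *: q + q') = c *: (0, q) + (0, q') :> rsp X * V.
    exact: inr_linear.
  by rewrite linearP.
have h2 p : (h (p, 0)).2 = 0.
  by have := hg v (p, 0); rewrite /= brep_v eqxx linear0 => -[_ <-].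
have h1 q : (h (0, q)).1 = 0.
  by have /(congr1 fst) := hg v (0, q); rewrite /= !brep_v eqxx.
exists (lin lal), (lin lbe); split=> [x p|p q] /=.
  have /(congr1 fst) := hg x (p, 0); rewrite /= => <-.
  by rewrite if_same.
rewrite -[(p, q)](_ : (p, 0) + (0, q) = _) ?linearD; last first.
  by congr pair; rewrite /= ?addr0 ?add0r.
by rewrite [h (p, 0)]surjective_pairing [h (0, q)]surjective_pairing h1 h2
  /=; congr pair; rewrite /= ?addr0 ?add0r.
Qed.

End Star.

Arguments in_inj {k Q v X} a u.
Arguments in_map {k Q v X X'} h m.

(** * Representations as linear maps from or to the incoming space *)

Section Reflection.
Variables (k : fieldType) (Q : quiver) (v : vertex Q).
Local Notation brep := (brep k v).
Local Notation incoming := (incoming v).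

(** For a sink v, a representation of Q amounts to one away from v, a space V at
    v and a linear map from the incoming space to V. *)
Section SinkRep.
Variables (X : brep) (V : lmodType k) (f : {linear incoming X -> V}).

Fact sink_ra_linear a :
  linear (fun u : rsp X * V => (ra X a u.1, f (in_inj a u.1))).
Proof. by move=> c u w; congr pair; rewrite /= !linearP. Qed.

Fact sink_ra_source a u :
  lin (sink_ra_linear a) (pair_rv X V (source a) u) = lin (sink_ra_linear a) u.
Proof. by rewrite /= ra_source in_inj_source. Qed.

Fact sink_ra_target a u :
  pair_rv X V (target a) (lin (sink_ra_linear a) u) = lin (sink_ra_linear a) u.
Proof.
rewrite /= ra_target; case: eqVneq => // ta.
by rewrite in_inj0 ?linear0.
Qed.

Definition sink_rep : rep k Q := @Rep k Q (rsp X * V)%type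
  (pair_rv X V) (fun a => lin (sink_ra_linear a)) (@pair_rvv _ _ _ X V)
  (@pair_rv_sum _ _ _ X V) sink_ra_source sink_ra_target.

End SinkRep.

(** In the mutation v is a source, and the same arrows assemble to a linear map
    from the space K at v to the incoming space. *)
Section SourceRep.
Variables (X : brep) (K : lmodType k) (g : {linear K -> incoming X}).

Fact source_ra_linear a :
  linear (fun u : rsp X * K => (ra X a u.1 + in_proj a (g u.2), 0 : K)).
Proof.
move=> c u w; congr pair; rewrite /= ?scaler0 ?addr0 // 3!linearP scalerDr.
by rewrite addrACA.
Qed.

Fact source_ra_source (a : arrow (mutation v)) u :
  lin (source_ra_linear a) (pair_rv X K (source a) u) = lin (source_ra_linear a) u.
Proof.
congr pair; rewrite /=; case: (eqVneq (@target Q a) v) => ta.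
  by rewrite ta eqxx !brep_ra.
by rewrite ra_source !in_proj0.
Qed.

Fact source_ra_target (a : arrow (mutation v)) u :
  pair_rv X K (target a) (lin (source_ra_linear a) u) = lin (source_ra_linear a) u.
Proof.
congr pair; rewrite /= ?if_same //; case: (eqVneq (@target Q a) v) => ta.
  by rewrite brep_ra // add0r in_proj_source.
by rewrite in_proj0 // addr0 ra_target.
Qed.

Definition source_rep : rep k (mutation v) := @Rep k (mutation v) (rsp X * K)%type
  (pair_rv X K) (fun a => lin (source_ra_linear a)) (@pair_rvv _ _ _ X K)
  (@pair_rv_sum _ _ _ X K) source_ra_source source_ra_target.

End SourceRep.

Fact pair_map_linear (X X' V V' : lmodType k) (al : {linear X -> X'})
  (be : {linear V -> V'}) : linear (fun u : X * V => (al u.1, be u.2)).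
Proof. by move=> c u w; congr pair; rewrite /= linearP. Qed.

Section Hom.
Variables (X X' : brep).
Implicit Types (al : {linear rsp X -> rsp X'}).

Section SinkHom.
Variables (V V' : lmodType k).
Variables (f : {linear incoming X -> V}) (f' : {linear incoming X' -> V'}).

Definition sink_hom al (be : {linear V -> V'}) : Prop :=
  rhom al /\ forall m, be (f m) = f' (in_map al m).

Lemma sink_hom_rhom al be : sink_hom al be ->
  rhom (lin (pair_map_linear al be) : {linear rsp (sink_rep f) -> rsp (sink_rep f')}).
Proof.
move=> [[av aa] bf]; split=> [x|a] u; rewrite /= ?av ?aa ?bf ?in_map_inj //.
by case: eqP; rewrite ?linear0.
Qed.

Lemma rhom_sink_hom (h : {linear rsp (sink_rep f) -> rsp (sink_rep f')}) : rhom h ->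
  exists (al : {linear rsp X -> rsp X'}) (be : {linear V -> V'}),
    sink_hom al be /\ forall p q, h (p, q) = (al p, be q).
Proof.
move=> [hv ha]; have [al [be [av hE]]] := pair_graded hv.
exists al, be; split=> //.
have hap a p : (al (ra X a p), be (f (in_inj a p))) =
    (ra X' a (al p), f' (in_inj a (al p))).
  by have := ha a (p, 0); rewrite /= !hE.
split; first by split=> // a u; case: (hap a u).
apply: (incoming_hom_ext (f := be \o f) (g := f' \o in_map al)) => a u /=.
by rewrite in_map_inj //; case: (hap a u).
Qed.

End SinkHom.

Section SourceHom.
Variables (K K' : lmodType k).
Variables (g : {linear K -> incoming X}) (g' : {linear K' -> incoming X'}).

Definition source_hom al (ga : {linear K -> K'}) : Prop :=
  rhom al /\ forall q, in_map al (g q) = g' (ga q).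

Lemma source_hom_rhom al ga : source_hom al ga ->
  rhom (lin (pair_map_linear al ga) :
    {linear rsp (source_rep g) -> rsp (source_rep g')}).
Proof.
move=> [[av aa] gaE]; split=> [x|a] u; rewrite /= ?av.
  by case: eqP; rewrite ?linear0.
by rewrite linear0 linearD /= aa -gaE in_proj_map.
Qed.

Lemma rhom_source_hom (h : {linear rsp (source_rep g) -> rsp (source_rep g')}) :
  rhom h -> exists (al : {linear rsp X -> rsp X'}) (ga : {linear K -> K'}),
    source_hom al ga /\ forall p q, h (p, q) = (al p, ga q).
Proof.
move=> [hv ha]; have [al [ga [av hE]]] := @pair_graded k Q v X X' K K' h hv.
exists al, ga; split=> //.
have haq a p q : al (ra X a p + in_proj a (g q)) =
    ra X' a (al p) + in_proj a (g' (ga q)).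
  by have /(congr1 fst) := ha a (p, q); rewrite /= !hE.
split=> [|q].
  by split=> // a p; have := haq a p 0; rewrite !linear0 !addr0.
by apply: incoming_ext => a; rewrite in_proj_map //; have := haq a 0 q;
  rewrite !linear0 !add0r.
Qed.

End SourceHom.
End Hom.

(** The decomposition of a total space U into its component at v and the rest; it
    serves both for Q and for the mutation, whose arrows away from v agree. *)
Section Decomposition.
Variables (U : lmodType k) (rvU : vertex Q -> {linear U -> U})
  (raU : arrow Q -> {linear U -> U}).
Hypothesis rvUU : forall x y u, rvU x (rvU y u) = if x == y then rvU y u else 0.
Hypothesis rvU_sum : forall u, \sum_x rvU x u = u.

Fact away_linear : linear (fun u => u - rvU v u).
Proof. by move=> c u w; rewrite linearP scalerBr opprD addrACA. Qed.

Definition away : {linear U -> U} := lin away_linear.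

Fact rvU_away u : rvU v (away u) = 0.
Proof. by rewrite linearB /= rvUU eqxx subrr. Qed.

Fact away_rvU u : away (rvU v u) = 0.
Proof. by rewrite /= rvUU eqxx subrr. Qed.

Definition to_away (u : U) : ker (rvU v) := ker_lift rvU_away u.
Definition to_at (u : U) : ker away := ker_lift away_rvU u.

Fact to_away_linear : linear to_away.
Proof. exact: linearP. Qed.
HB.instance Definition _ :=
  GRing.isLinear.Build k U (ker (rvU v)) *:%R to_away to_away_linear.

Fact to_at_linear : linear to_at.
Proof. exact: linearP. Qed.
HB.instance Definition _ :=
  GRing.isLinear.Build k U (ker away) *:%R to_at to_at_linear.

Lemma to_awayE u : ker_in (to_away u) = u - rvU v u.
Proof. exact: ker_liftE. Qed.

Lemma to_atE u : ker_in (to_at u) = rvU v u.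
Proof. exact: ker_liftE. Qed.

Lemma rvU_ker (p : ker (rvU v)) : rvU v (ker_in p) = 0.
Proof. exact: ker_inP. Qed.

Lemma rvU_at (q : ker away) : rvU v (ker_in q) = ker_in q.
Proof. by have /eqP := ker_inP q; rewrite /= subr_eq0 => /eqP. Qed.

Hypothesis ra_sourceU : forall a u, rvU v u = 0 ->
  away (raU a (rvU (source a) u)) = away (raU a u).
Hypothesis ra_targetU : forall a u, rvU v u = 0 ->
  rvU (target a) (away (raU a u)) = away (raU a u).

Fact rvU_rv_ker x (p : ker (rvU v)) : rvU v (rvU x (ker_in p)) = 0.
Proof. by rewrite rvUU; case: eqP => // <-; exact: rvU_ker. Qed.

Lemma away_rv x (p : ker (rvU v)) :
  ker_in (to_away (rvU x (ker_in p))) = rvU x (ker_in p).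
Proof. by rewrite to_awayE rvU_rv_ker subr0. Qed.

Program Definition away_rep : rep k Q := @Rep k Q (ker (rvU v))
  (fun x => to_away \o rvU x \o ker_in)
  (fun a => to_away \o raU a \o ker_in) _ _ _ _.
Next Obligation.
by apply: ker_in_inj; rewrite /= !away_rv rvUU; case: eqP => _;
  rewrite ?away_rv ?linear0.
Qed.
Next Obligation.
apply: ker_in_inj; rewrite linear_sum /= -[RHS]rvU_sum.
by apply: eq_bigr => x _; rewrite away_rv.
Qed.
Next Obligation.
apply: ker_in_inj; rewrite /= away_rv !to_awayE.
exact: (ra_sourceU _ (rvU_ker u)).
Qed.
Next Obligation.
apply: ker_in_inj; rewrite /= away_rv !to_awayE.
exact: (ra_targetU _ (rvU_ker u)).
Qed.

Fact away_rep_v u : rv away_rep v u = 0.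
Proof. by apply: ker_in_inj; rewrite /= away_rv rvU_ker linear0. Qed.

Definition away_brep : brep := BRep away_rep_v.

Fact join_linear :
  linear (fun u : ker (rvU v) * ker away => ker_in u.1 + ker_in u.2).
Proof. by move=> c u w; rewrite !linearP scalerDr addrACA. Qed.

Definition join : {linear (ker (rvU v) * ker away)%type -> U} := lin join_linear.

Definition unjoin (u : U) : ker (rvU v) * ker away := (to_away u, to_at u).

Lemma unjoinK : cancel unjoin join.
Proof. by move=> u; rewrite /= to_awayE to_atE subrK. Qed.

Lemma joinK : cancel join unjoin.
Proof.
move=> [p q]; congr pair; apply: ker_in_inj;
  rewrite ?to_awayE ?to_atE linearD /= rvU_ker rvU_at add0r //.
by rewrite addrK.
Qed.

Lemma join_rv x u : join (pair_rv away_brep (ker away) x u) = rvU x (join u).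
Proof.
rewrite /= away_rv linearD /=; congr (_ + _).
by rewrite -[in RHS]rvU_at rvUU; case: eqP => _; rewrite ?rvU_at ?linear0.
Qed.

End Decomposition.

Lemma sink_rep_full (r : rep k Q) : is_sink v ->
  exists (X : brep) (V : lmodType k) (f : {linear incoming X -> V}),
    isomorphic (rep_mod (sink_rep f)) (rep_mod r).
Proof.
move=> hv; set e := rv r v.
have in_v a u : target a = v -> e (ra r a u) = ra r a u.
  by move=> ta; rewrite /e -ta ra_target.
have off_v a u : target a != v -> e (ra r a u) = 0.
  by move=> ta; rewrite /e -ra_target rv_eq0 // eq_sym.
have hs a u : e u = 0 ->
    away (rv r) (ra r a (rv r (source a) u)) = away (rv r) (ra r a u).
  by rewrite ra_source.
have ht a u : e u = 0 ->
    rv r (target a) (away (rv r) (ra r a u)) = away (rv r) (ra r a u).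
  move=> _; rewrite /=; case: (eqVneq (target a) v) => ta.
    by rewrite in_v // subrr linear0.
  by rewrite off_v // subr0 ra_target.
pose X := away_brep (@rvv _ _ r) (@rv_sum _ _ r) hs ht.
have flin : linear (fun m : incoming X =>
    \sum_a to_at (@rvv _ _ r) (ra r a (ker_in (in_proj a m)))).
  move=> c m n; rewrite scaler_sumr -big_split; apply: eq_bigr => a _ /=.
  by rewrite !linearP.
exists X, _, (lin flin).
have hj : rhom (join (rv r) : {linear rsp (sink_rep (lin flin)) -> rsp r}).
  split=> [x u|a [p q]]; first exact: join_rv.
  rewrite /= to_awayE linear_sum linearD /=.
  rewrite (bigD1 a) //= big1 => [|b ba]; last first.
    by rewrite in_proj_inj (negPf ba) /= !linear0.
  rewrite addr0 to_atE in_proj_inj eqxx /=.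
  have -> : ra r a (ker_in q) = 0.
    by rewrite -(rvU_at q) -ra_source rv_eq0 ?linear0 //; apply/eqP; exact: hv.
  rewrite addr0; case: eqP => [ta|/eqP ta]; last first.
    by rewrite off_v // subr0 !linear0 addr0.
  by rewrite !in_v // subrr add0r /= away_rv ra_source.
exists (lin (rhom_linear hj)); exists (unjoin (@rvv _ _ r)).
  exact: joinK.
exact: unjoinK.
Qed.

Lemma source_rep_full (r : rep k (mutation v)) : is_sink v ->
  exists (X : brep) (K : lmodType k) (g : {linear K -> incoming X}),
    isomorphic (rep_mod (source_rep g)) (rep_mod r).
Proof.
move=> hv; pose rvr : vertex Q -> {linear rsp r -> rsp r} := rv r.
pose rar : arrow Q -> {linear rsp r -> rsp r} := ra r.
have rvvr : forall x y u, rvr x (rvr y u) = if x == y then rvr y u else 0.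
  exact: (@rvv _ _ r).
have sumr u : \sum_x rvr x u = u by exact: (@rv_sum _ _ r).
have src0 (a : arrow Q) : source a != v by apply/eqP; exact: hv.
(* In the mutated quiver the arrows at v start there. *)
have s_in a u : target a = v -> rar a (rvr v u) = rar a u.
  by move=> ta; have := @ra_source _ _ r a u; rewrite /= ta eqxx.
have s_off a u : target a != v -> rar a (rvr (source a) u) = rar a u.
  by move=> ta; have := @ra_source _ _ r a u; rewrite /= (negPf ta).
have t_in a u : target a = v -> rvr (source a) (rar a u) = rar a u.
  by move=> ta; have := @ra_target _ _ r a u; rewrite /= ta eqxx.
have t_off a u : target a != v -> rvr (target a) (rar a u) = rar a u.
  by move=> ta; have := @ra_target _ _ r a u; rewrite /= (negPf ta).
have rv0 x y u : x != y -> rvr x (rvr y u) = 0 by rewrite rvvr => /negPf->.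
have ker0 a u : target a = v -> rvr v u = 0 -> rar a u = 0.
  by move=> ta u0; rewrite -s_in // u0 linear0.
have av a u : rvr v (rar a u) = 0.
  case: (eqVneq (target a) v) => ta; first by rewrite -t_in // rv0 // eq_sym.
  by rewrite -t_off // rv0 // eq_sym.
have hs a u : rvr v u = 0 ->
    away rvr (rar a (rvr (source a) u)) = away rvr (rar a u).
  move=> u0; case: (eqVneq (target a) v) => ta; last by rewrite s_off.
  by rewrite !ker0 // rv0 // eq_sym.
have ht a u : rvr v u = 0 ->
    rvr (target a) (away rvr (rar a u)) = away rvr (rar a u).
  move=> u0; rewrite /= av subr0; case: (eqVneq (target a) v) => ta.
    by rewrite ker0 // linear0.
  by rewrite t_off.
pose X := away_brep rvvr sumr hs ht.
have glin : linear (fun q : ker (away rvr) =>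
    \sum_a in_inj a (to_away rvvr (rar a (ker_in q)) : rsp X) : incoming X).
  move=> c m n; rewrite scaler_sumr -big_split; apply: eq_bigr => a _ /=.
  by rewrite !linearP.
exists X, _, (lin glin).
have hj : rhom (join rvr : {linear rsp (source_rep (lin glin)) -> rsp r}).
  split=> [x u|a [p q]]; first exact: join_rv.
  rewrite /= !linear_sum linear0 addr0 linearD /=.
  rewrite (bigD1 a) //= big1 => [|b ba]; last first.
    by rewrite in_proj_inj eq_sym (negPf ba).
  rewrite addr0 in_proj_inj eqxx /= to_awayE [rvr v _]av subr0.
  rewrite [RHS]linearD; congr (_ + _).
  case: eqP => [ta|/eqP ta] /=.
    by rewrite away_rv to_awayE av subr0 t_in.
  by rewrite linear0 -(rvU_at q) -[RHS]s_off // rv0 // linear0.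
exists (lin (rhom_linear hj)); exists (unjoin rvvr).
  exact: joinK.
exact: unjoinK.
Qed.

End Reflection.

(** * Two correspondences between modules over the two path algebras *)

Section Retract.
Variable L : pzRingType.
Implicit Types A B U : lmodType L.

Definition retract A U : Prop :=
  exists (i : {linear A -> U}) (p : {linear U -> A}), cancel i p.

Lemma iso_retract A U : isomorphic A U -> retract A U.
Proof. by move=> /isomorphicP[f [g [fg _]]]; exists f, g. Qed.

Lemma retract_trans A B U : retract A B -> retract B U -> retract A U.
Proof.
move=> [i [p pi]] [i' [p' pi']].
exists (i' \o i), (p \o p'); exact: (can_comp pi' pi).
Qed.

Lemma retract_iso2 A U A' U' :
  retract A U -> isomorphic A A' -> isomorphic U U' -> retract A' U'.
Proof.
move=> rAU iA iU; apply: retract_trans (iso_retract (iso_sym iA)) _.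
exact: retract_trans rAU (iso_retract iU).
Qed.

Lemma dsum_retractl A B : retract A (dsum A B).
Proof.
have li : linear (fun x : A => (x, 0) : dsum A B).
  by move=> c x y; congr pair; rewrite /= scaler0 addr0.
have lp : linear (fun x : dsum A B => x.1) by [].
by exists (lin li), (lin lp).
Qed.

Lemma summand_retract A B U : isomorphic U (dsum A B) -> retract A U /\ retract B U.
Proof.
move=> iU; split.
  exact: retract_trans (dsum_retractl A B) (iso_retract (iso_sym iU)).
apply: retract_trans (dsum_retractl B A) _; apply: iso_retract.
exact: iso_trans (iso_dsumC B A) (iso_sym iU).
Qed.

End Retract.

Section Defect.
Variables (k : pzRingType) (U V : lmodType k).
Variables (s : {linear V -> U}) (f : {linear U -> V}).

(** The projection onto the kernel of f along the image of s, when s is a section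
    of f. *)
Definition defect (x : U) : U := x - s (f x).

Fact defect_linear : linear defect.
Proof. by move=> c x y; rewrite /defect 2!linearP scalerBr opprD addrACA. Qed.

HB.instance Definition _ := GRing.isLinear.Build k U U *:%R defect defect_linear.

Lemma defect_ret x : cancel s f -> f (defect x) = 0.
Proof. by move=> sK; rewrite /defect linearB /= sK subrr. Qed.

Lemma defect_img y : cancel s f -> defect (s y) = 0.
Proof. by move=> sK; rewrite /defect sK subrr. Qed.

End Defect.

Section Relations.
Variables (k : fieldType) (Q : quiver) (v : vertex Q).
Local Notation brep := (brep k v).
Local Notation incoming := (incoming v).
Local Notation L := (path_algebra k Q).
Local Notation L' := (path_algebra k (mutation v)).

Section Homs.
Variables X X' : brep.

Lemma retract_sink_hom (V V' : lmodType k) (f : {linear incoming X -> V})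
    (f' : {linear incoming X' -> V'}) :
  retract (rep_mod (sink_rep f)) (rep_mod (sink_rep f')) ->
  exists (al : {linear rsp X -> rsp X'}) (be : {linear V -> V'})
      (al' : {linear rsp X' -> rsp X}) (be' : {linear V' -> V}),
    [/\ sink_hom f f' al be, sink_hom f' f al' be', cancel al al' & cancel be be'].
Proof.
move=> [i [p pi]]; have [h hh hE] := linear_rhom i; have [h' hh' hE'] := linear_rhom p.
have [al [be [hab abE]]] := rhom_sink_hom hh.
have [al' [be' [hab' abE']]] := rhom_sink_hom hh'.
have hK x q : (al' (al x), be' (be q)) = (x, q).
  by rewrite -abE' -abE hE' hE pi.
exists al, be, al', be'; split=> // [x|q]; first by case: (hK x 0).
by case: (hK 0 q).
Qed.

Lemma retract_source_hom (K K' : lmodType k) (g : {linear K -> incoming X})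
    (g' : {linear K' -> incoming X'}) :
  retract (rep_mod (source_rep g)) (rep_mod (source_rep g')) ->
  exists (al : {linear rsp X -> rsp X'}) (ga : {linear K -> K'})
      (al' : {linear rsp X' -> rsp X}) (ga' : {linear K' -> K}),
    [/\ source_hom g g' al ga, source_hom g' g al' ga', cancel al al' & cancel ga ga'].
Proof.
move=> [i [p pi]]; have [h hh hE] := linear_rhom i; have [h' hh' hE'] := linear_rhom p.
have [al [ga [hab abE]]] := rhom_source_hom hh.
have [al' [ga' [hab' abE']]] := rhom_source_hom hh'.
have hK x q : (al' (al x), ga' (ga q)) = (x, q).
  by rewrite -abE' -abE hE' hE pi.
exists al, ga, al', ga'; split=> // [x|q]; first by case: (hK x 0).
by case: (hK 0 q).
Qed.

Lemma iso_sink_hom (V V' : lmodType k) (f : {linear incoming X -> V})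
    (f' : {linear incoming X' -> V'}) :
  isomorphic (rep_mod (sink_rep f)) (rep_mod (sink_rep f')) ->
  exists (al : {linear rsp X -> rsp X'}) (be : {linear V -> V'})
      (al' : {linear rsp X' -> rsp X}) (be' : {linear V' -> V}),
    [/\ sink_hom f f' al be /\ sink_hom f' f al' be',
        cancel al al' /\ cancel al' al & cancel be be' /\ cancel be' be].
Proof.
move=> /rep_isoP[h [h' [hh hh' hK h'K]]].
have [al [be [hab abE]]] := rhom_sink_hom hh.
have [al' [be' [hab' abE']]] := rhom_sink_hom hh'.
have K1 x q : (al' (al x), be' (be q)) = (x, q) by rewrite -abE' -abE hK.
have K2 x q : (al (al' x), be (be' q)) = (x, q) by rewrite -abE -abE' h'K.
exists al, be, al', be'; split=> //; split=> x.
- by case: (K1 x 0).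
- by case: (K2 x 0).
- by case: (K1 0 x).
- by case: (K2 0 x).
Qed.

Lemma iso_source_hom (K K' : lmodType k) (g : {linear K -> incoming X})
    (g' : {linear K' -> incoming X'}) :
  isomorphic (rep_mod (source_rep g)) (rep_mod (source_rep g')) ->
  exists (al : {linear rsp X -> rsp X'}) (ga : {linear K -> K'})
      (al' : {linear rsp X' -> rsp X}) (ga' : {linear K' -> K}),
    [/\ source_hom g g' al ga /\ source_hom g' g al' ga',
        cancel al al' /\ cancel al' al & cancel ga ga' /\ cancel ga' ga].
Proof.
move=> /rep_isoP[h [h' [hh hh' hK h'K]]].
have [al [ga [hab abE]]] := rhom_source_hom hh.
have [al' [ga' [hab' abE']]] := rhom_source_hom hh'.
have K1 x q : (al' (al x), ga' (ga q)) = (x, q) by rewrite -abE' -abE hK.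
have K2 x q : (al (al' x), ga (ga' q)) = (x, q) by rewrite -abE -abE' h'K.
exists al, ga, al', ga'; split=> //; split=> x.
- by case: (K1 x 0).
- by case: (K2 x 0).
- by case: (K1 0 x).
- by case: (K2 0 x).
Qed.

Lemma sink_hom_iso (V V' : lmodType k) (f : {linear incoming X -> V})
    (f' : {linear incoming X' -> V'}) (al : {linear rsp X -> rsp X'})
    (be : {linear V -> V'}) al' be' :
  sink_hom f f' al be -> cancel al al' -> cancel al' al ->
  cancel be be' -> cancel be' be ->
  isomorphic (rep_mod (sink_rep f)) (rep_mod (sink_rep f')).
Proof.
move=> h aK a'K bK b'K; exists (lin (rhom_linear (sink_hom_rhom h))).
by exists (fun u => (al' u.1, be' u.2)) => -[x q] /=; rewrite ?aK ?bK ?a'K ?b'K.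
Qed.

Lemma source_hom_iso (K K' : lmodType k) (g : {linear K -> incoming X})
    (g' : {linear K' -> incoming X'}) (al : {linear rsp X -> rsp X'})
    (ga : {linear K -> K'}) al' ga' :
  source_hom g g' al ga -> cancel al al' -> cancel al' al ->
  cancel ga ga' -> cancel ga' ga ->
  isomorphic (rep_mod (source_rep g)) (rep_mod (source_rep g')).
Proof.
move=> h aK a'K bK b'K; exists (lin (rhom_linear (source_hom_rhom h))).
by exists (fun u => (al' u.1, ga' u.2)) => -[x q] /=; rewrite ?aK ?bK ?a'K ?b'K.
Qed.

End Homs.

Lemma hom_in_mapK (X X' : brep) (al : {linear rsp X -> rsp X'})
    (al' : {linear rsp X' -> rsp X}) :
  rhom al -> rhom al' -> cancel al al' ->
  cancel (in_map (v := v) al) (in_map (v := v) al').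
Proof. by move=> [ga _] [ga' _]; exact: in_mapK. Qed.

Section RetractSplitting.
Variables (X X' : brep).

Lemma sink_retract_sec (V V' : lmodType k) (f : {linear incoming X -> V})
    (f' : {linear incoming X' -> V'}) (s : {linear V' -> incoming X'}) :
  retract (rep_mod (sink_rep f)) (rep_mod (sink_rep f')) -> cancel s f' ->
  exists s' : {linear V -> incoming X}, cancel s' f.
Proof.
move=> /retract_sink_hom[al [be [al' [be' [[_ ab] [_ ab'] _ bK]]]]] sK.
by exists (in_map al' \o s \o be) => q /=; rewrite -ab' sK bK.
Qed.

Lemma sink_retract_ret (V V' : lmodType k) (f : {linear incoming X -> V})
    (f' : {linear incoming X' -> V'}) (r : {linear V' -> incoming X'}) :
  retract (rep_mod (sink_rep f)) (rep_mod (sink_rep f')) -> cancel f' r ->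
  exists r' : {linear V -> incoming X}, cancel f r'.
Proof.
move=> /retract_sink_hom[al [be [al' [be' [[ra ab] [ra' _] aK _]]]]] rK.
by exists (in_map al' \o r \o be) => m /=; rewrite ab rK (hom_in_mapK ra ra').
Qed.

Lemma source_retract_ret (K K' : lmodType k) (g : {linear K -> incoming X})
    (g' : {linear K' -> incoming X'}) (r : {linear incoming X' -> K'}) :
  retract (rep_mod (source_rep g)) (rep_mod (source_rep g')) -> cancel g' r ->
  exists r' : {linear incoming X -> K}, cancel g r'.
Proof.
move=> /retract_source_hom[al [ga [al' [ga' [[_ ag] _ _ gK]]]]] rK.
by exists (ga' \o r \o in_map al) => q /=; rewrite ag rK gK.
Qed.

Lemma source_retract_sec (K K' : lmodType k) (g : {linear K -> incoming X})
    (g' : {linear K' -> incoming X'}) (s : {linear incoming X' -> K'}) :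
  retract (rep_mod (source_rep g)) (rep_mod (source_rep g')) -> cancel s g' ->
  exists s' : {linear incoming X -> K}, cancel s' g.
Proof.
move=> /retract_source_hom[al [ga [al' [ga' [[ra _] [ra' ag'] aK _]]]]] sK.
by exists (ga' \o s \o in_map al) => m /=; rewrite -ag' sK (hom_in_mapK ra ra').
Qed.

End RetractSplitting.

(** The four classes below are the modules without the simple at v as a summand
    (sink_sec, source_ret), and the sums of a module with bijective structure map
    and copies of that simple (sink_ret, source_sec). *)
Definition sink_sec (U : lmodType L) : Prop :=
  exists (X : brep) (V : lmodType k) (f : {linear incoming X -> V})
      (s : {linear V -> incoming X}),
    cancel s f /\ isomorphic U (rep_mod (sink_rep f)).

Definition sink_ret (U : lmodType L) : Prop :=
  exists (X : brep) (V : lmodType k) (f : {linear incoming X -> V})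
      (r : {linear V -> incoming X}),
    cancel f r /\ isomorphic U (rep_mod (sink_rep f)).

Definition source_ret (W : lmodType L') : Prop :=
  exists (X : brep) (K : lmodType k) (g : {linear K -> incoming X})
      (r : {linear incoming X -> K}),
    cancel g r /\ isomorphic W (rep_mod (source_rep g)).

Definition source_sec (W : lmodType L') : Prop :=
  exists (X : brep) (K : lmodType k) (g : {linear K -> incoming X})
      (s : {linear incoming X -> K}),
    cancel s g /\ isomorphic W (rep_mod (source_rep g)).

Definition split_exact (X : brep) (K V : lmodType k)
    (g : {linear K -> incoming X}) (f : {linear incoming X -> V})
    (r : {linear incoming X -> K}) (s : {linear V -> incoming X}) : Prop :=
  [/\ cancel g r, cancel s f, forall q, f (g q) = 0 &
      forall m, g (r m) + s (f m) = m].

(** The reflection functors of Bernstein, Gelfand and Ponomarev, on the modules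
    without the simple at v as a summand: V and K are exchanged along
    0 -> K -> incoming X -> V -> 0. *)
Definition bgp (U : lmodType L) (W : lmodType L') : Prop :=
  exists (X : brep) (K V : lmodType k)
      (g : {linear K -> incoming X}) (f : {linear incoming X -> V})
      (r : {linear incoming X -> K}) (s : {linear V -> incoming X}),
    [/\ split_exact g f r s, isomorphic U (rep_mod (sink_rep f)) &
        isomorphic W (rep_mod (source_rep g))].

(** The space at v is kept, and the structure map f is replaced by a retraction of
    it: the simple at v over Q becomes the simple at v over the mutation. *)
Definition swap (U : lmodType L) (W : lmodType L') : Prop :=
  exists (X : brep) (V : lmodType k) (f : {linear incoming X -> V})
      (r : {linear V -> incoming X}),
    [/\ cancel f r, isomorphic U (rep_mod (sink_rep f)) &
        isomorphic W (rep_mod (source_rep r))].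

Hypothesis hv : is_sink v.

Lemma sink_mod_full (U : lmodType L) :
  exists (X : brep) (V : lmodType k) (f : {linear incoming X -> V}),
    isomorphic U (rep_mod (sink_rep f)).
Proof.
have [X [V [f i]]] := sink_rep_full (mod_rep U) hv; exists X, V, f.
exact: iso_trans (iso_mod_rep U) (iso_sym i).
Qed.

Lemma source_mod_full (W : lmodType L') :
  exists (X : brep) (K : lmodType k) (g : {linear K -> incoming X}),
    isomorphic W (rep_mod (source_rep g)).
Proof.
have [X [K [g i]]] := source_rep_full (mod_rep W) hv; exists X, K, g.
exact: iso_trans (iso_mod_rep W) (iso_sym i).
Qed.

Lemma sink_sec_retract U A : sink_sec U -> retract A U -> sink_sec A.
Proof.
move=> [X' [V' [f' [s [sK iU]]]]] rA; have [X [V [f iA]]] := sink_mod_full A.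
have [s' s'K] := sink_retract_sec (retract_iso2 rA iA iU) sK.
by exists X, V, f, s'.
Qed.

Lemma sink_ret_retract U A : sink_ret U -> retract A U -> sink_ret A.
Proof.
move=> [X' [V' [f' [s [sK iU]]]]] rA; have [X [V [f iA]]] := sink_mod_full A.
have [s' s'K] := sink_retract_ret (retract_iso2 rA iA iU) sK.
by exists X, V, f, s'.
Qed.

Lemma source_ret_retract W A : source_ret W -> retract A W -> source_ret A.
Proof.
move=> [X' [V' [f' [s [sK iU]]]]] rA; have [X [V [f iA]]] := source_mod_full A.
have [s' s'K] := source_retract_ret (retract_iso2 rA iA iU) sK.
by exists X, V, f, s'.
Qed.

Lemma source_sec_retract W A : source_sec W -> retract A W -> source_sec A.
Proof.
move=> [X' [V' [f' [s [sK iU]]]]] rA; have [X [V [f iA]]] := source_mod_full A.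
have [s' s'K] := source_retract_sec (retract_iso2 rA iA iU) sK.
by exists X, V, f, s'.
Qed.

Lemma bgp_total U : sink_sec U -> exists W, bgp U W.
Proof.
move=> [X [V [f [s [sK iU]]]]].
have fd m : f (defect s f m) = 0 by exact: defect_ret.
pose g : {linear ker f -> incoming X} := ker_in.
pose r : {linear incoming X -> ker f} := ker_lift fd.
exists (rep_mod (source_rep g)), X, _, V, g, f, r, s; split=> //; last exact: iso_refl.
split=> // [q|q|m]; last by rewrite /= ker_liftE /= subrK.
  by apply: ker_in_inj; rewrite /= ker_liftE /= /defect ker_inP linear0 subr0.
exact: ker_inP.
Qed.

Lemma bgp_surj W : source_ret W -> exists U, bgp U W.
Proof.
move=> [X [K [g [r [rK iW]]]]].
have rd m : r (defect g r m) = 0 by exact: defect_ret.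
pose s : {linear ker r -> incoming X} := ker_in.
pose f : {linear incoming X -> ker r} := ker_lift rd.
exists (rep_mod (sink_rep f)), X, K, _, g, f, r, s; split=> //; last exact: iso_refl.
split=> // [q|q|m]; last by rewrite /= ker_liftE /= addrC subrK.
  by apply: ker_in_inj; rewrite /= ker_liftE /= /defect ker_inP linear0 subr0.
by apply: ker_in_inj; rewrite /= ker_liftE /= defect_img // linear0.
Qed.

Lemma swap_total U : sink_ret U -> exists W, swap U W.
Proof.
move=> [X [V [f [r [rK iU]]]]]; exists (rep_mod (source_rep r)), X, V, f, r.
by split=> //; exact: iso_refl.
Qed.

Lemma swap_surj W : source_sec W -> exists U, swap U W.
Proof.
move=> [X [V [r [f [rK iW]]]]]; exists (rep_mod (sink_rep f)), X, V, f, r.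
by split=> //; exact: iso_refl.
Qed.

Lemma bgp_sec U W : bgp U W -> sink_sec U.
Proof. by move=> [X [K [V [g [f [r [s [[]]]]]]]]] *; exists X, V, f, s. Qed.

Lemma bgp_ret U W : bgp U W -> source_ret W.
Proof. by move=> [X [K [V [g [f [r [s [[]]]]]]]]] *; exists X, K, g, r. Qed.

Lemma swap_ret U W : swap U W -> sink_ret U.
Proof. by move=> [X [V [f [r []]]]] *; exists X, V, f, r. Qed.

Lemma swap_sec U W : swap U W -> source_sec W.
Proof. by move=> [X [V [f [r []]]]] *; exists X, V, r, f. Qed.

(** A morphism of the maps f induces one of their kernels g. *)
Lemma bgp_funl U W W' : bgp U W -> bgp U W' -> isomorphic W W'.
Proof.
move=> [X [K [V [g [f [r [s [[rK sK fg dec] iU iW]]]]]]]].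
move=> [X' [K' [V' [g' [f' [r' [s' [[r'K s'K f'g' dec'] iU' iW']]]]]]]].
have [al [be [al' [be' [[[ra ab] [ra' ab']] [aK a'K] [bK b'K]]]]]] :=
  iso_sink_hom (iso_trans (iso_sym iU) iU').
have mK := hom_in_mapK ra ra' aK; have m'K := hom_in_mapK ra' ra a'K.
pose ga : {linear K -> K'} := r' \o in_map al \o g.
pose ga' : {linear K' -> K} := r \o in_map al' \o g'.
have gaE q : in_map al (g q) = g' (ga q).
  by rewrite -[LHS]dec' -ab fg !linear0 addr0.
have gaE' q : in_map al' (g' q) = g (ga' q).
  by rewrite -[LHS]dec -ab' f'g' !linear0 addr0.
apply: iso_trans iW (iso_trans _ (iso_sym iW')).
apply: (@source_hom_iso _ _ _ _ g g' al ga al' ga') => // q.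
  by rewrite /ga' /= -gaE mK rK.
by rewrite /ga /= -gaE' m'K r'K.
Qed.

(** A morphism of the maps g induces one of their cokernels f. *)
Lemma bgp_funr U U' W : bgp U W -> bgp U' W -> isomorphic U U'.
Proof.
move=> [X [K [V [g [f [r [s [[rK sK fg dec] iU iW]]]]]]]].
move=> [X' [K' [V' [g' [f' [r' [s' [[r'K s'K f'g' dec'] iU' iW']]]]]]]].
have [al [ga [al' [ga' [[[ra ag] [ra' ag']] [aK a'K] [gK g'K]]]]]] :=
  iso_source_hom (iso_trans (iso_sym iW) iW').
have mK := hom_in_mapK ra ra' aK; have m'K := hom_in_mapK ra' ra a'K.
pose be : {linear V -> V'} := f' \o in_map al \o s.
pose be' : {linear V' -> V} := f \o in_map al' \o s'.
have beE m : be (f m) = f' (in_map al m).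
  by rewrite -{2}[m]dec !linearD /= ag f'g' add0r.
have beE' m : be' (f' m) = f (in_map al' m).
  by rewrite -{2}[m]dec' !linearD /= ag' fg add0r.
apply: iso_trans iU (iso_trans _ (iso_sym iU')).
apply: (@sink_hom_iso _ _ _ _ f f' al be al' be') => // q.
  by rewrite [be q](_ : _ = f' (in_map al (s q))) // beE' mK sK.
by rewrite [be' q](_ : _ = f (in_map al' (s' q))) // beE m'K s'K.
Qed.

(** A morphism of the maps f, or of the retractions r, respects one of the
    summands of V = im f + ker r; keeping its action on the quotient by that
    summand, and copying al on the other, makes it respect both. *)
Lemma split_transfer (X X' : brep) (V V' : lmodType k)
    (f : {linear incoming X -> V}) (f' : {linear incoming X' -> V'})
    (r : {linear V -> incoming X}) (r' : {linear V' -> incoming X'})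
    (al : {linear rsp X -> rsp X'}) (be : {linear V -> V'}) :
    cancel f r -> cancel f' r' ->
  exists de : {linear V -> V'}, [/\ forall m, de (f m) = f' (in_map al m),
    forall q, r' (de q) = in_map al (r q) &
    forall q, de q = f' (in_map al (r q)) + defect f' r' (be (defect f r q))].
Proof.
move=> rK r'K.
have d_lin : linear (fun q => f' (in_map al (r q)) +
    defect f' r' (be (defect f r q))).
  by move=> c q q'; rewrite 6!linearP scalerDr addrACA.
exists (lin d_lin); split=> [m|q|//] /=.
  by rewrite rK defect_img // !linear0 addr0.
by rewrite linearD /= r'K defect_ret // addr0.
Qed.

(** Both choices of compatible be are covered: those that commute with f, and
    those that commute with r. *)
Lemma split_transferK (X X' : brep) (V V' : lmodType k)
    (f : {linear incoming X -> V}) (f' : {linear incoming X' -> V'})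
    (r : {linear V -> incoming X}) (r' : {linear V' -> incoming X'})
    (al : {linear rsp X -> rsp X'}) (al' : {linear rsp X' -> rsp X})
    (be be' de de' : {linear _ -> _}) :
    cancel f r -> cancel f' r' -> rhom al -> rhom al' -> cancel al al' ->
    cancel be be' ->
    (forall q, de q = f' (in_map al (r q)) + defect f' r' (be (defect f r q))) ->
    (forall q, de' q = f (in_map al' (r' q)) + defect f r (be' (defect f' r' q))) ->
    (forall q, r' (de q) = in_map al (r q)) ->
    (forall m, be' (f' m) = f (in_map al' m)) \/
      (forall q, in_map al (r q) = r' (be q)) ->
  cancel de de'.
Proof.
move=> rK r'K ra ra' aK bK deE de'E rde compat q.
have mK := hom_in_mapK ra ra' aK.
have dd : defect f' r' (de q) = defect f' r' (be (defect f r q)).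
  by rewrite {1}/defect rde deE addrC addKr.
rewrite de'E rde mK dd.
suff -> : defect f r (be' (defect f' r' (be (defect f r q)))) = defect f r q.
  by rewrite /defect addrC subrK.
rewrite {2}/defect linearB /= bK linearB /=.
case: compat => [b'f|br].
  by rewrite b'f defect_img // subr0 /defect linearB /= rK subrr linear0 subr0.
rewrite -br defect_ret // !linear0 addr0.
by rewrite /defect linearB /= rK subrr linear0 subr0.
Qed.

Lemma swap_funl U W W' : swap U W -> swap U W' -> isomorphic W W'.
Proof.
move=> [X [V [f [r [rK iU iW]]]]] [X' [V' [f' [r' [r'K iU' iW']]]]].
have [al [be [al' [be' [[[ra ab] [ra' ab']] [aK a'K] [bK b'K]]]]]] :=
  iso_sink_hom (iso_trans (iso_sym iU) iU').
have [de [_ rde deE]] := split_transfer al be rK r'K.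
have [de' [_ rde' deE']] := split_transfer al' be' r'K rK.
apply: iso_trans iW (iso_trans _ (iso_sym iW')).
apply: (@source_hom_iso _ _ _ _ r r' al de al' de') => //.
  by split=> // q; rewrite rde.
  by apply: (split_transferK rK r'K ra ra' aK bK deE deE' rde); left.
by apply: (split_transferK r'K rK ra' ra a'K b'K deE' deE rde'); left.
Qed.

Lemma swap_funr U U' W : swap U W -> swap U' W -> isomorphic U U'.
Proof.
move=> [X [V [f [r [rK iU iW]]]]] [X' [V' [f' [r' [r'K iU' iW']]]]].
have [al [be [al' [be' [[[ra ab] [ra' ab']] [aK a'K] [bK b'K]]]]]] :=
  iso_source_hom (iso_trans (iso_sym iW) iW').
have [de [fde rde deE]] := split_transfer al be rK r'K.
have [de' [fde' rde' deE']] := split_transfer al' be' r'K rK.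
apply: iso_trans iU (iso_trans _ (iso_sym iU')).
apply: (@sink_hom_iso _ _ _ _ f f' al de al' de') => //.
  by apply: (split_transferK rK r'K ra ra' aK bK deE deE' rde); right.
by apply: (split_transferK r'K rK ra' ra a'K b'K deE' deE rde'); right.
Qed.

End Relations.

(** * Additivity of the two correspondences *)

Section Additivity.
Variables (k : fieldType) (Q : quiver) (v : vertex Q).
Local Notation brep := (brep k v).
Local Notation incoming := (incoming v).
Local Notation L := (path_algebra k Q).
Local Notation L' := (path_algebra k (mutation v)).
Implicit Types (U : lmodType L) (W : lmodType L').

Section Sum.
Variables X Y : brep.

Fact sum_brep_v (u : rsp (rsum X Y)) : rv (rsum X Y) v u = 0.
Proof. by rewrite /= !brep_v. Qed.

Definition sum_brep : brep := BRep sum_brep_v.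

Definition in_fst : {linear incoming sum_brep -> incoming X} := in_map (rfst X Y).
Definition in_snd : {linear incoming sum_brep -> incoming Y} := in_map (rsnd X Y).
Definition in_inl : {linear incoming X -> incoming sum_brep} := in_map (rinl X Y).
Definition in_inr : {linear incoming Y -> incoming sum_brep} := in_map (rinr X Y).

Lemma in_fstl m : in_fst (in_inl m) = m.
Proof. by apply: incoming_ext => a; rewrite !in_proj_map //; exact: (rinl_rhom X Y).1. Qed.

Lemma in_sndr m : in_snd (in_inr m) = m.
Proof. by apply: incoming_ext => a; rewrite !in_proj_map //; exact: (rinr_rhom X Y).1. Qed.

Lemma in_fstr m : in_fst (in_inr m) = 0.
Proof.
by apply: incoming_ext => a; rewrite !in_proj_map ?linear0 //;
  exact: (rinr_rhom X Y).1.
Qed.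

Lemma in_sndl m : in_snd (in_inl m) = 0.
Proof.
by apply: incoming_ext => a; rewrite !in_proj_map ?linear0 //;
  exact: (rinl_rhom X Y).1.
Qed.

Lemma in_sum m : in_inl (in_fst m) + in_inr (in_snd m) = m.
Proof.
apply: incoming_ext => a; rewrite linearD /= !in_proj_map //.
- by rewrite /=; case: (in_proj a m) => x y; congr pair; rewrite /= ?addr0 ?add0r.
- exact: (rinr_rhom X Y).1.
- exact: (rinl_rhom X Y).1.
Qed.

Lemma in_fst_inj a u : in_fst (in_inj a u) = in_inj a u.1.
Proof. exact: in_map_inj. Qed.

Lemma in_snd_inj a u : in_snd (in_inj a u) = in_inj a u.2.
Proof. exact: in_map_inj. Qed.

Lemma in_proj_inl a m : in_proj a (in_inl m) = (in_proj a m, 0).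
Proof. by apply: in_proj_map; exact: (rinl_rhom X Y).1. Qed.

Lemma in_proj_inr a m : in_proj a (in_inr m) = (0, in_proj a m).
Proof. by apply: in_proj_map; exact: (rinr_rhom X Y).1. Qed.

Section SumMap.
Variables (V W : lmodType k).

Section Out.
Variables (f : {linear incoming X -> V}) (f' : {linear incoming Y -> W}).

Definition out_sum (m : incoming sum_brep) : (V * W)%type :=
  (f (in_fst m), f' (in_snd m)).

Fact out_sum_linear : linear out_sum.
Proof. by move=> c m n; congr pair; rewrite /= !linearP. Qed.

HB.instance Definition _ :=
  GRing.isLinear.Build k (incoming sum_brep) (V * W)%type *:%R out_sum out_sum_linear.

End Out.

Section In.
Variables (g : {linear V -> incoming X}) (g' : {linear W -> incoming Y}).

Definition in_sum_map (q : V * W) : incoming sum_brep :=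
  in_inl (g q.1) + in_inr (g' q.2).

Fact in_sum_map_linear : linear in_sum_map.
Proof. by move=> c q q'; rewrite /in_sum_map /= !linearP scalerDr addrACA. Qed.

HB.instance Definition _ :=
  GRing.isLinear.Build k (V * W)%type (incoming sum_brep) *:%R in_sum_map
    in_sum_map_linear.

End In.
End SumMap.

Lemma in_sum_mapK (V W : lmodType k)
    (g : {linear V -> incoming X}) (g' : {linear W -> incoming Y})
    (f : {linear incoming X -> V}) (f' : {linear incoming Y -> W}) :
  cancel g f -> cancel g' f' -> cancel (in_sum_map g g') (out_sum f f').
Proof.
move=> gK g'K [q q']; rewrite /out_sum /in_sum_map !linearD.
by congr pair; rewrite /= ?in_fstl ?in_fstr ?in_sndl ?in_sndr ?linear0 ?addr0 ?add0r.
Qed.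

Lemma out_sumK (V W : lmodType k)
    (g : {linear V -> incoming X}) (g' : {linear W -> incoming Y})
    (f : {linear incoming X -> V}) (f' : {linear incoming Y -> W}) :
  cancel f g -> cancel f' g' -> cancel (out_sum f f') (in_sum_map g g').
Proof. by move=> fK f'K m; rewrite /in_sum_map /= fK f'K in_sum. Qed.

Definition swap_mid (A B C D : Type) (u : A * B * (C * D)) : A * C * (B * D) :=
  (u.1.1, u.2.1, (u.1.2, u.2.2)).

Fact swap_mid_linear (A B C D : lmodType k) : linear (@swap_mid A B C D).
Proof. by []. Qed.

Lemma sink_rep_sum (V W : lmodType k)
    (f : {linear incoming X -> V}) (f' : {linear incoming Y -> W}) :
  isomorphic (dsum (rep_mod (sink_rep f)) (rep_mod (sink_rep f')))
    (rep_mod (sink_rep (out_sum f f'))).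
Proof.
apply: iso_trans (rsum_iso _ _) _.
have h : rhom (lin (@swap_mid_linear (rsp X) V (rsp Y) W) :
    {linear rsp (rsum (sink_rep f) (sink_rep f')) ->
     rsp (sink_rep (out_sum f f'))}).
  split=> [x|a] [[p q] [p' q']]; rewrite /swap_mid /=.
    by case: eqP.
  by rewrite /out_sum /= in_fst_inj in_snd_inj.
exists (lin (rhom_linear h)); exists (@swap_mid (rsp X) (rsp Y) V W) => //.
  by move=> [[? ?] [? ?]].
by move=> [[? ?] [? ?]].
Qed.

Lemma source_rep_sum (V W : lmodType k)
    (g : {linear V -> incoming X}) (g' : {linear W -> incoming Y}) :
  isomorphic (dsum (rep_mod (source_rep g)) (rep_mod (source_rep g')))
    (rep_mod (source_rep (in_sum_map g g'))).
Proof.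
apply: iso_trans (rsum_iso _ _) _.
have h : rhom (lin (@swap_mid_linear (rsp X) V (rsp Y) W) :
    {linear rsp (rsum (source_rep g) (source_rep g')) ->
     rsp (source_rep (in_sum_map g g'))}).
  split=> [x|a] [[p q] [p' q']]; rewrite /swap_mid /=.
    by case: eqP.
  rewrite /in_sum_map linearD /= in_proj_inl in_proj_inr.
  by congr pair; congr pair; rewrite /= ?addr0 ?add0r.
exists (lin (rhom_linear h)); exists (@swap_mid (rsp X) (rsp Y) V W) => //.
  by move=> [[? ?] [? ?]].
by move=> [[? ?] [? ?]].
Qed.

End Sum.

Lemma bgp_dsum U U' W W' : bgp U W -> bgp U' W' ->
  bgp (dsum U U') (dsum W W').
Proof.
move=> [X [K [V [g [f [r [s [[rK sK fg dec] iU iW]]]]]]]].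
move=> [Y [K' [V' [g' [f' [r' [s' [[r'K s'K f'g' dec'] iU' iW']]]]]]]].
exists (sum_brep X Y), _, _, (in_sum_map g g'), (out_sum f f'), (out_sum r r'),
  (in_sum_map s s'); split.
- split; try exact: in_sum_mapK.
    move=> [q q']; rewrite /= /out_sum /in_sum_map !linearD /=.
    by rewrite in_fstl in_fstr in_sndl in_sndr !linear0 fg f'g' !addr0.
  move=> m; rewrite /= /in_sum_map /= addrACA -!linearD /= dec dec'.
  exact: in_sum.
- exact: iso_trans (iso_dsum iU iU') (sink_rep_sum f f').
- exact: iso_trans (iso_dsum iW iW') (source_rep_sum g g').
Qed.

Lemma swap_dsum U U' W W' : swap U W -> swap U' W' ->
  swap (dsum U U') (dsum W W').
Proof.
move=> [X [V [f [r [rK iU iW]]]]] [Y [V' [f' [r' [r'K iU' iW']]]]].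
exists (sum_brep X Y), _, (out_sum f f'), (in_sum_map r r'); split.
- exact: out_sumK.
- exact: iso_trans (iso_dsum iU iU') (sink_rep_sum f f').
- exact: iso_trans (iso_dsum iW iW') (source_rep_sum r r').
Qed.

Lemma incoming0 (X : brep) : is_zero (rsp X) -> is_zero (incoming X).
Proof. by move=> X0 m; apply: incoming_ext => a; rewrite linear0; exact: X0. Qed.

Lemma is_zero_pair (A B : lmodType k) : is_zero (A * B)%type <-> is_zero A /\ is_zero B.
Proof.
split=> [AB|[A0 B0] [x y]]; last by rewrite (A0 x) (B0 y).
split=> [x|y]; first by have [] := AB (x, 0).
by have [] := AB (0, y).
Qed.

Lemma bgp_zero U W : bgp U W -> is_zero U <-> is_zero W.
Proof.
move=> [X [K [V [g [f [r [s [[rK sK _ _] iU iW]]]]]]]].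
split=> [/(iso_is_zero iU)|/(iso_is_zero iW)].
  move=> U0; have [X0 _] := (is_zero_pair (rsp X) V).1 U0.
  apply: iso_is_zero (iso_sym iW) _; apply/(is_zero_pair (rsp X) K).
  by split=> // q; rewrite -[q]rK (incoming0 X0 (g q)) linear0.
move=> W0; have [X0 _] := (is_zero_pair (rsp X) K).1 W0.
apply: iso_is_zero (iso_sym iU) _; apply/(is_zero_pair (rsp X) V).
by split=> // q; rewrite -[q]sK (incoming0 X0 (s q)) linear0.
Qed.

(** Summands are treated by building a partner of each from the total relation
    and comparing the sum of the partners with the given one. *)
Lemma corr_intro (R : lmodType L -> lmodType L' -> Prop)
    (S : lmodType L -> Prop) (T : lmodType L' -> Prop) :
    (forall U U' W, R U W -> isomorphic U U' -> R U' W) ->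
    (forall U W W', R U W -> isomorphic W W' -> R U W') ->
    (forall U W W', R U W -> R U W' -> isomorphic W W') ->
    (forall U U' W, R U W -> R U' W -> isomorphic U U') ->
    (forall U U' W W', R U W -> R U' W' -> R (dsum U U') (dsum W W')) ->
    (forall U W, R U W -> is_zero U <-> is_zero W) ->
    (forall U W, R U W -> S U) -> (forall U, S U -> exists W, R U W) ->
    (forall U A, S U -> retract A U -> S A) ->
    (forall U W, R U W -> T W) -> (forall W, T W -> exists U, R U W) ->
    (forall W A, T W -> retract A W -> T A) ->
  correspondence R.
Proof.
move=> isol isor funl funr sumR zeroR RS tS rS RT tT rT; split=> //.
- move=> U W A B rUW iU; have [rA rB] := summand_retract iU.
  have [A' rAA'] := tS _ (rS _ _ (RS _ _ rUW) rA).
  have [B' rBB'] := tS _ (rS _ _ (RS _ _ rUW) rB).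
  exists A', B'; split=> //; apply: funl (isol _ _ _ rUW iU) _.
  exact: sumR.
- move=> U W A' B' rUW iW; have [rA rB] := summand_retract iW.
  have [A rAA'] := tT _ (rT _ _ (RT _ _ rUW) rA).
  have [B rBB'] := tT _ (rT _ _ (RT _ _ rUW) rB).
  exists A, B; split=> //; apply: funr (isor _ _ _ rUW iW) _.
  exact: sumR.
- by move=> U W /zeroR[].
- by move=> U W /zeroR[].
Qed.

Hypothesis hv : is_sink v.

Lemma bgp_corr : correspondence (@bgp k Q v).
Proof.
apply: (@corr_intro _ (@sink_sec k Q v) (@source_ret k Q v)).
- move=> U U' W [X [K [V [g [f [r [s [sp iU iW]]]]]]]] i.
  exists X, K, V, g, f, r, s; split=> //; exact: iso_trans (iso_sym i) iU.
- move=> U W W' [X [K [V [g [f [r [s [sp iU iW]]]]]]]] i.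
  exists X, K, V, g, f, r, s; split=> //; exact: iso_trans (iso_sym i) iW.
- exact: bgp_funl.
- exact: bgp_funr.
- exact: bgp_dsum.
- exact: bgp_zero.
- exact: bgp_sec.
- exact: bgp_total.
- exact: sink_sec_retract.
- exact: bgp_ret.
- exact: bgp_surj.
- exact: source_ret_retract.
Qed.

Lemma swap_zero U W : swap U W -> is_zero U <-> is_zero W.
Proof.
move=> [X [V [f [r [_ iU iW]]]]].
by split=> [/(iso_is_zero iU) U0|/(iso_is_zero iW) W0];
  [apply: iso_is_zero (iso_sym iW) _|apply: iso_is_zero (iso_sym iU) _].
Qed.

Lemma swap_corr : correspondence (@swap k Q v).
Proof.
apply: (@corr_intro _ (@sink_ret k Q v) (@source_sec k Q v)).
- move=> U U' W [X [V [f [r [rK iU iW]]]]] i.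
  exists X, V, f, r; split=> //; exact: iso_trans (iso_sym i) iU.
- move=> U W W' [X [V [f [r [rK iU iW]]]]] i.
  exists X, V, f, r; split=> //; exact: iso_trans (iso_sym i) iW.
- exact: swap_funl.
- exact: swap_funr.
- exact: swap_dsum.
- exact: swap_zero.
- exact: swap_ret.
- exact: swap_total.
- exact: sink_ret_retract.
- exact: swap_sec.
- exact: swap_surj.
- exact: source_sec_retract.
Qed.

End Additivity.

(** * Rigidity under the two correspondences *)

Section Rigidity.
Variables (k : fieldType) (Q : quiver) (v : vertex Q).
Local Notation brep := (brep k v).
Local Notation incoming := (incoming v).

(** The triviality of cocycles in terms of the data (X, V, f) and (X, K, g): the
    components tau are those on the arrows at v. *)
Definition sink_trivial (X : brep) (V : lmodType k) (f : {linear incoming X -> V}) :=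
  forall theta (tau : {linear incoming X -> V}), cocycle theta ->
  exists (b : {linear rsp X -> rsp X}) (c : {linear V -> V}), bounds theta b /\
    forall m, tau m = f (in_map b m) - c (f m).

Definition source_trivial (X : brep) (K : lmodType k) (g : {linear K -> incoming X}) :=
  forall theta (tau : {linear K -> incoming X}), cocycle theta ->
  exists (b : {linear rsp X -> rsp X}) (c : {linear K -> K}), bounds theta b /\
    forall q, tau q = g (c q) - in_map b (g q).

(** Given b, the equation for c on the sink side is solvable as soon as it holds on
    the kernel of f, that is after composition with g; on the source side, as soon
    as it holds modulo the image of g, that is after composition with f. Both
    reduce to the same condition on a map from K to V. *)
Lemma split_sink_source (X : brep) (K V : lmodType k)
    (g : {linear K -> incoming X}) (f : {linear incoming X -> V})
    (r : {linear incoming X -> K}) (s : {linear V -> incoming X}) :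
  split_exact g f r s -> sink_trivial f <-> source_trivial g.
Proof.
move=> [rK sK fg dec]; split=> triv theta tau ct.
  have [b [c [tb tau_b]]] := triv theta (\- (f \o tau \o r)) ct.
  exists b, (r \o (tau \+ (in_map b \o g))); split=> // q.
  have f0 : f (tau q + in_map b (g q)) = 0.
    have := tau_b (g q); rewrite /= rK fg linear0 subr0 linearD /= => <-.
    exact: subrr.
  have := dec (tau q + in_map b (g q)); rewrite f0 linear0 addr0 /= => ->.
  by rewrite addrK.
have [b [c [tb tau_b]]] := triv theta (\- (s \o tau \o g)) ct.
have fb q : f (in_map b (g q)) = tau (g q).
  have /(congr1 f) := tau_b q; rewrite /= linearN linearB /= sK fg sub0r.
  by move=> /oppr_inj.
exists b, ((f \o in_map b \o s) \- (tau \o s)); split=> // m /=.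
rewrite -{1 2}[m]dec !linearD /= fb.
by rewrite opprK addrA addrK.
Qed.

(** When f is split injective, or r split surjective, the equation for c can be
    solved whatever b and tau are: both sides say that X is rigid. *)
Lemma ret_sink_source (X : brep) (V : lmodType k) (f : {linear incoming X -> V})
    (r : {linear V -> incoming X}) :
  cancel f r -> sink_trivial f <-> source_trivial r.
Proof.
move=> rK; split=> triv theta tau ct.
  have [b [c [tb _]]] := triv theta \0 ct.
  exists b, (f \o (tau \+ (in_map b \o r))); split=> // q /=.
  by rewrite rK addrK.
have [b [c [tb _]]] := triv theta \0 ct.
exists b, (((f \o in_map b) \- tau) \o r); split=> // m /=.
by rewrite rK opprB addrCA subrr addr0.
Qed.

(** If f is neither injective nor surjective, a map tau that sends a nonzero vector
    of the kernel of f outside its image is not bounded: it is a non-trivial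
    extension by a summand simple at v. *)
Lemma sink_trivial_split (X : brep) (V : lmodType k) (f : {linear incoming X -> V}) :
  sink_trivial f -> injective f \/ forall q, exists m, f m = q.
Proof.
move=> triv; have [|/existsNP[q nq]] := pselect (forall q, exists m, f m = q).
  by right.
left=> m n fmn; apply/eqP; rewrite -subr_eq0; apply/negP => /negP d0.
have [tau tauE] := linear_sep q d0.
have [|b [c [_ tb]]] := triv (fun=> \0) tau.
  by split=> a u //=; rewrite linear0.
apply: nq; exists (in_map b (m - n)).
have f0 : f (m - n) = 0 by rewrite linearB /= fmn subrr.
by rewrite -tauE tb f0 linear0 subr0.
Qed.

Lemma source_trivial_split (X : brep) (K : lmodType k) (g : {linear K -> incoming X}) :
  source_trivial g -> injective g \/ forall m, exists q, g q = m.
Proof.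
move=> triv; have [|/existsNP[m nm]] := pselect (forall m, exists q, g q = m).
  by right.
left=> p q gpq; apply/eqP; rewrite -subr_eq0; apply/negP => /negP d0.
have [tau tauE] := linear_sep m d0.
have [|b [c [_ tb]]] := triv (fun=> \0) tau.
  by split=> a u //=; rewrite linear0.
have g0 : g (p - q) = 0 by rewrite linearB /= gpq subrr.
by apply: nm; exists (c (p - q)); rewrite -tauE tb g0 linear0 subr0.
Qed.

Hypothesis hv : is_sink v.

Lemma source_neq a : (source a == v) = false.
Proof. by apply/eqP; exact: hv. Qed.

Section Sink.
Variables (X : brep) (V : lmodType k) (f : {linear incoming X -> V}).

Lemma cocycle_sink : cocycle_trivial (sink_rep f) -> sink_trivial f.
Proof.
move=> triv theta tau [cs ct].
have Tlin a : linear (fun u : rsp X * V => (theta a u.1, tau (in_inj a u.1))).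
  by move=> c u w; congr pair; rewrite /= !linearP.
have [|b [gb bE]] := triv (fun a => lin (Tlin a)).
  split=> a u; first by rewrite /= cs in_inj_source.
  rewrite /= ct; case: eqVneq => // ta.
  by rewrite in_inj0 // linear0.
have [al [c [gal abE]]] := pair_graded gb.
have aE a p : (theta a p, tau (in_inj a p)) = (ra X a (al p) - al (ra X a p),
    f (in_inj a (al p)) - c (f (in_inj a p))).
  by have := bE a (p, 0); rewrite /= !abE.
exists al, c; split; first by split=> // a u; case: (aE a u).
apply: (incoming_hom_ext (g := (f \o in_map al) \- (c \o f))) => a u /=.
by rewrite in_map_inj //; case: (aE a u).
Qed.

Lemma sink_cocycle : sink_trivial f -> cocycle_trivial (sink_rep f).
Proof.
move=> triv T [Ts Tt].
have Tl a p q : T a (p, q) = T a (p, 0).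
  by rewrite -Ts -[RHS]Ts /= source_neq.
have th_lin a : linear (fun p => (T a (p, 0)).1).
  move=> c p p'; have -> : (c *: p + p', 0) = c *: (p, 0) + (p', 0) :> rsp X * V.
    exact: inl_linear.
  by rewrite linearP.
have tau_lin : linear (fun m : incoming X => \sum_a (T a (in_proj a m, 0)).2).
  move=> c m n; rewrite scaler_sumr -big_split; apply: eq_bigr => a _ /=.
  have -> : (in_proj a (c *: m + n), 0) =
      c *: (in_proj a m, 0) + (in_proj a n, 0) :> rsp X * V.
    by rewrite linearP; exact: inl_linear.
  by rewrite linearP.
have [|b [c [[gb bE] tb]]] := triv (fun a => lin (th_lin a)) (lin tau_lin).
  split=> a p /=; first by rewrite -[in RHS]Ts /= source_neq.
  by have /(congr1 fst) := Tt a (p, 0).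
exists (lin (pair_map_linear b c)); split=> [x u|a [p q]] /=.
  by rewrite gb; case: eqP; rewrite ?linear0.
rewrite Tl [LHS]surjective_pairing; congr pair; first exact: bE.
have := tb (in_inj a p); rewrite /= in_map_inj // => <-.
rewrite (bigD1 a) //= big1 => [|b' ba]; last first.
  by rewrite in_proj_inj (negPf ba) (linear0 (T b')).
rewrite addr0 in_proj_inj eqxx /=; case: (eqVneq (target a) v) => ta.
  by rewrite -[in LHS]Ts /= source_neq.
have /(congr1 snd) := Tt a (p, 0); rewrite /= (negPf ta) => <-.
by rewrite (linear0 (T a)).
Qed.

End Sink.

Section Source.
Variables (X : brep) (K : lmodType k) (g : {linear K -> incoming X}).

Lemma cocycle_source : cocycle_trivial (source_rep g) -> source_trivial g.
Proof.
move=> triv theta tau [cs ct].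
have th0 a p : target a = v -> theta a p = 0 by move=> ta; rewrite -ct ta brep_v.
have Tlin a : linear (fun u : rsp X * K =>
    (theta a u.1 + in_proj a (tau u.2), 0 : K)).
  move=> c u w; congr pair; rewrite /= ?scaler0 ?addr0 //.
  by rewrite 3!linearP scalerDr addrACA.
have [|b [gb bE]] := triv (fun a => lin (Tlin a)).
  split=> a u; congr pair; rewrite /= ?if_same //;
    case: (eqVneq (@target Q a) v) => ta.
  - by rewrite ta eqxx !th0.
  - by rewrite cs !in_proj0.
  - by rewrite th0 // add0r in_proj_source.
  - by rewrite in_proj0 // addr0 ct.
have [al [c [gal abE]]] := @pair_graded k Q v X X K K b gb.
have aE a p q : theta a p + in_proj a (tau q) =
    ra X a (al p) + in_proj a (g (c q)) - al (ra X a p + in_proj a (g q)).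
  by have /(congr1 fst) := bE a (p, q); rewrite /= !abE.
exists al, c; split=> [|q].
  split=> // a p; have := aE a p 0.
  by rewrite !linear0 !addr0.
apply: incoming_ext => a; rewrite linearB /= in_proj_map //.
by have := aE a 0 q; rewrite !linear0 !add0r.
Qed.

Lemma source_cocycle : source_trivial g -> cocycle_trivial (source_rep g).
Proof.
move=> triv T [Ts Tt].
have s_in a p q : target a = v -> T a (0, q) = T a (p, q).
  by move=> ta; rewrite -[RHS]Ts /= ta !eqxx brep_v.
have s_off a p q : target a != v -> T a (rv X (source a) p, 0) = T a (p, q).
  by move=> ta; rewrite -[RHS]Ts /= (negPf ta) source_neq.
have T2 a u : (T a u).2 = 0.
  have /(congr1 snd) := Tt a u; rewrite /=; case: (eqVneq (@target Q a) v) => ta.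
    by rewrite source_neq.
  by rewrite (negPf ta).
have t_in a u : target a = v -> rv X (source a) (T a u).1 = (T a u).1.
  by move=> ta; have /(congr1 fst) := Tt a u; rewrite /= ta eqxx.
have t_off a u : target a != v -> rv X (target a) (T a u).1 = (T a u).1.
  by move=> ta; have /(congr1 fst) := Tt a u; rewrite /= (negPf ta).
have th_lin a : linear (fun p => (T a (p, 0)).1).
  move=> c p p'; have -> : (c *: p + p', 0) = c *: (p, 0) + (p', 0) :> rsp X * K.
    exact: inl_linear.
  by rewrite linearP.
have tau_lin : linear (fun q : K => \sum_(a : arrow Q) in_inj a ((T a (0, q)).1 : rsp X) : incoming X).
  move=> c p q; rewrite scaler_sumr -big_split; apply: eq_bigr => a _ /=.
  have -> : (0, c *: p + q) = c *: (0, p) + (0, q) :> rsp X * K.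
    exact: inr_linear.
  by rewrite linearP /= linearP.
have th0 (a : arrow Q) p : target a = v -> (T a (p, 0)).1 = 0.
  by move=> ta; rewrite -s_in // (linear0 (T a)).
have [|b [c [[gb bE] tb]]] := triv (fun a => lin (th_lin a)) (lin tau_lin).
  split=> a p /=; case: (eqVneq (target a) v) => ta.
  - by rewrite !th0.
  - by rewrite (s_off a p 0).
  - by rewrite th0 // linear0.
  - by rewrite t_off.
have T1 a q : in_proj a (lin tau_lin q) = (T a (0, q)).1.
  rewrite /= linear_sum (bigD1 a) //= big1 => [|b' ba]; last first.
    by rewrite in_proj_inj eq_sym (negPf ba).
  rewrite addr0 in_proj_inj eqxx /=; case: (eqVneq (target a) v) => ta.
    exact: t_in.
  by rewrite -(s_off a 0 q ta) linear0 (linear0 (T a)).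
exists (lin (pair_map_linear b c)); split=> [x u|a [p q]] /=.
  by rewrite gb; case: eqP; rewrite ?linear0.
have Tpq : T a (p, q) = T a (p, 0) + T a (0, q).
  by rewrite -linearD; congr (T a (_, _)); rewrite /= ?addr0 ?add0r.
rewrite [LHS]surjective_pairing T2; congr pair; last by rewrite linear0 subr0.
rewrite Tpq /= -T1 tb linearB /= in_proj_map //.
have /= -> := bE a p.
by rewrite linearD opprD addrACA.
Qed.

End Source.

End Rigidity.

(** * The bijection of isomorphism classes *)

Section Classes.

Lemma iso_classE (L : pzRingType) (U U' : lmodType L) :
  isomorphic U = isomorphic U' <-> isomorphic U U'.
Proof.
split=> [->|iU]; first exact: iso_refl.
apply/funext => A; apply/propext; split; first exact: (iso_trans (iso_sym iU)).
exact: (iso_trans iU).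
Qed.

Lemma rigid_class_inj (L : pzRingType) i (c d : rigid_classes L i) :
  sval c = sval d -> c = d.
Proof.
case: c d => [C Cp] [D Dp] /= CD; rewrite CD in Cp *.
by congr exist; exact: Prop_irrelevance.
Qed.

Lemma classes_bijection (L L' : pzRingType) i
    (R : lmodType L -> lmodType L' -> Prop) :
    (forall U W W', R U W -> isomorphic W W' -> R U W') ->
    (forall U U' W, R U W -> isomorphic U U' -> R U' W) ->
    (forall U W W', R U W -> R U W' -> isomorphic W W') ->
    (forall U U' W, R U W -> R U' W -> isomorphic U U') ->
    (forall U, basic_rigid i U -> exists W, R U W /\ basic_rigid i W) ->
    (forall W, basic_rigid i W -> exists U, R U W /\ basic_rigid i U) ->
  exists f : rigid_classes L i -> rigid_classes L' i, bijective f.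
Proof.
move=> isor isol funl funr totl totr.
pose P (c : rigid_classes L i) (d : rigid_classes L' i) := exists U W,
  [/\ sval c = isomorphic U, sval d = isomorphic W & R U W].
have Pl c : exists d, P c d.
  have [U bU cE] := proj2_sig c; have [W [rUW bW]] := totl U bU.
  by exists (exist _ (isomorphic W) (ex_intro2 _ _ W bW erefl)), U, W.
have Pr d : exists c, P c d.
  have [W bW dE] := proj2_sig d; have [U [rUW bU]] := totr W bW.
  by exists (exist _ (isomorphic U) (ex_intro2 _ _ U bU erefl)), U, W.
have [f fP] := choice Pl; have [g gP] := choice Pr.
exists f; exists g => [c|d]; apply: rigid_class_inj.
  have [U [W [-> dE rUW]]] := fP c; have [U' [W' [-> dE' rUW']]] := gP (f c).
  apply/iso_classE; apply: funr rUW' _; apply: isor rUW _.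
  by apply/iso_classE; rewrite -dE.
have [U [W [cE -> rUW]]] := gP d; have [U' [W' [cE' -> rUW']]] := fP (g d).
apply/iso_classE; apply: funl rUW' _; apply: isol rUW _.
by apply/iso_classE; rewrite -cE.
Qed.

End Classes.

Section Mutation.
Variables (Q : quiver) (v : vertex Q).

Lemma mutation_acyclic : acyclic Q -> is_sink v -> acyclic (mutation v).
Proof.
move=> hQ hv; case=> -[x s] ps; rewrite /psource /ptarget /parrows /=.
(* No arrow of the mutation ends at v, so neither does a cycle start there. *)
have tgt (a : arrow (mutation v)) : target a != v :> vertex Q.
  by rewrite /=; case: ifP => [_|/negbT //]; apply/eqP; exact: hv.
have keep y t : y != v -> is_qpath (Q := mutation v) y t -> is_qpath (Q := Q) y t /\
    map (@target (mutation v)) t = map (@target Q) t.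
  elim: t y => // a t IHt y yv /= /andP[/eqP sa pt].
  have av : (@target Q a == v) = false.
    by apply/negP => /eqP av; move: sa yv; rewrite av eqxx => <-; rewrite eqxx.
  have [qt ->] := IHt _ (tgt a) pt; rewrite /= av in sa qt *.
  by split=> //; rewrite sa eqxx.
case: s ps => // a s ps xs.
have xv : x != v.
  by rewrite xs /= last_map; exact: tgt.
have [qs ms] := keep x (a :: s) xv ps.
apply: (hQ (@QPath Q (x, a :: s) qs)).
by rewrite /psource /ptarget /parrows -[map _ _]ms.
Qed.

End Mutation.

Section Reflection.
Variables (k : fieldType) (Q : quiver) (v : vertex Q).
Hypotheses (hQ : acyclic Q) (hv : is_sink v).
Local Notation brep := (brep k v).
Local Notation incoming := (incoming v).
Local Notation L := (path_algebra k Q).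
Local Notation L' := (path_algebra k (mutation v)).
Implicit Types (U : lmodType L) (W : lmodType L').

Lemma rigid_sink U (X : brep) (V : lmodType k) (f : {linear incoming X -> V}) :
  isomorphic U (rep_mod (sink_rep f)) -> rigid U <-> sink_trivial f.
Proof.
move=> iU; split=> [/(rigid_iso iU)/rigid_cocycle/cocycle_sink //|].
by move=> /(sink_cocycle hv)/cocycle_rigid/(rigid_iso (iso_sym iU)).
Qed.

Lemma rigid_source W (X : brep) (K : lmodType k) (g : {linear K -> incoming X}) :
  isomorphic W (rep_mod (source_rep g)) -> rigid W <-> source_trivial g.
Proof.
move=> iW; split=> [/(rigid_iso iW)/rigid_cocycle/cocycle_source //|].
by move=> /(source_cocycle hv)/cocycle_rigid/(rigid_iso (iso_sym iW)).
Qed.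

Lemma bgp_rigid U W : bgp U W -> rigid U <-> rigid W.
Proof.
move=> [X [K [V [g [f [r [s [sp iU iW]]]]]]]].
apply: iff_trans (rigid_sink iU) _.
exact: iff_trans (split_sink_source sp) (iff_sym (rigid_source iW)).
Qed.

Lemma swap_rigid U W : swap U W -> rigid U <-> rigid W.
Proof.
move=> [X [V [f [r [rK iU iW]]]]]; apply: iff_trans (rigid_sink iU) _.
exact: iff_trans (ret_sink_source rK) (iff_sym (rigid_source iW)).
Qed.

Lemma rigid_sink_split U : rigid U -> sink_sec v U \/ sink_ret v U.
Proof.
have [X [V [f iU]]] := sink_mod_full hv U.
move=> /(rigid_sink iU)/sink_trivial_split[/linear_retraction|/linear_section] [r rK].
  by right; exists X, V, f, r.
by left; exists X, V, f, r.
Qed.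

Lemma rigid_source_split W : rigid W -> source_ret W \/ source_sec W.
Proof.
have [X [K [g iW]]] := source_mod_full hv W.
move=> /(rigid_source iW)/source_trivial_split[/linear_retraction|/linear_section] [r rK].
  by left; exists X, K, g, r.
by right; exists X, K, g, r.
Qed.

Lemma fg_sink U (X : brep) (V : lmodType k) (f : {linear incoming X -> V}) :
  isomorphic U (rep_mod (sink_rep f)) ->
  finitely_generated U <-> finitely_generated (rsp X) /\ finitely_generated V.
Proof.
move=> iU; apply: iff_trans (fg_pair (rsp X) V).
apply: iff_trans (fg_rep hQ (sink_rep f)).
by split; apply: fg_iso => //; exact: iso_sym.
Qed.

Lemma fg_source W (X : brep) (K : lmodType k) (g : {linear K -> incoming X}) :
  isomorphic W (rep_mod (source_rep g)) ->
  finitely_generated W <-> finitely_generated (rsp X) /\ finitely_generated K.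
Proof.
move=> iW; apply: iff_trans (fg_pair (rsp X) K).
apply: iff_trans (fg_rep (mutation_acyclic hQ hv) (source_rep g)).
by split; apply: fg_iso => //; exact: iso_sym.
Qed.

Lemma bgp_fg U W : bgp U W -> finitely_generated U <-> finitely_generated W.
Proof.
move=> [X [K [V [g [f [r [s [[rK sK _ _] iU iW]]]]]]]].
apply: iff_trans (fg_sink iU) (iff_trans _ (iff_sym (fg_source iW))).
split=> -[fX _]; split=> //; have fM := fg_incoming v fX.
  by apply: fg_surj fM => q; exists (g q); exact: rK.
by apply: fg_surj fM => q; exists (s q); exact: sK.
Qed.

Lemma swap_fg U W : swap U W -> finitely_generated U <-> finitely_generated W.
Proof.
move=> [X [V [f [r [_ iU iW]]]]].
exact: iff_trans (fg_sink iU) (iff_sym (fg_source iW)).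
Qed.

Lemma corr_basic_rigid (R : lmodType L -> lmodType L' -> Prop) i :
    correspondence R ->
    (forall U W, R U W -> finitely_generated U <-> finitely_generated W) ->
    (forall U W, R U W -> rigid U <-> rigid W) ->
  forall U W, R U W -> basic_rigid i U <-> basic_rigid i W.
Proof.
move=> cR fgR rR U W rUW; split=> -[fgM bM rM nM]; split.
- exact/(fgR _ _ rUW).
- exact: (corr_basic cR rUW).
- exact/(rR _ _ rUW).
- exact: (corr_num_summands cR rUW).
- exact/(fgR _ _ rUW).
- exact: (corr_basic (corr_sym cR) rUW).
- exact/(rR _ _ rUW).
- exact: (corr_num_summands (corr_sym cR) rUW).
Qed.

Lemma bgp_basic_rigid i U W : bgp U W -> basic_rigid i U <-> basic_rigid i W.
Proof. exact: corr_basic_rigid (bgp_corr k hv) bgp_fg bgp_rigid _ _. Qed.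

Lemma swap_basic_rigid i U W : swap U W -> basic_rigid i U <-> basic_rigid i W.
Proof. exact: corr_basic_rigid (swap_corr k hv) swap_fg swap_rigid _ _. Qed.

(** A retraction with a retraction of its own is invertible. *)
Lemma swap_exclusive U W : swap U W -> source_ret W -> sink_sec v U.
Proof.
move=> [X [V [f [r [rK iU iW]]]]] [X' [K [g [r' [r'K iW']]]]].
have [q qK] := source_retract_ret
  (iso_retract (iso_trans (iso_sym iW) iW')) r'K.
exists X, V, f, r; split=> // y; apply: (can_inj qK).
by rewrite rK.
Qed.

(** A retraction of a surjective map is its inverse. *)
Lemma swap_source_ret U W : swap U W -> sink_sec v U -> source_ret W.
Proof.
move=> [X [V [f [r [rK iU iW]]]]] [X' [V' [f' [s' [s'K iU']]]]].
have [s sK] := sink_retract_sec (iso_retract (iso_trans (iso_sym iU) iU')) s'K.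
exists X, V, r, f; split=> // y.
by rewrite -[y]sK rK.
Qed.

(** The classes of the two correspondences overlap in the modules whose map at v
    is bijective; these are left to the reflection. *)
Definition mutation_rel U W : Prop := bgp U W \/ swap U W /\ ~ sink_sec v U.

Lemma sink_sec_iso U U' : isomorphic U U' -> sink_sec v U -> sink_sec v U'.
Proof.
by move=> iU /(sink_sec_retract hv); apply; exact: iso_retract (iso_sym iU).
Qed.

Lemma rigid_classes_mutation i :
  exists f : rigid_classes L i -> rigid_classes L' i, bijective f.
Proof.
have c1 := bgp_corr k hv; have c2 := swap_corr k hv.
apply: (@classes_bijection _ _ i mutation_rel).
- move=> U W W' [r|[r ns]] iW; first by left; exact: (corr_isor c1 r).
  by right; split=> //; exact: (corr_isor c2 r).
- move=> U U' W [r|[r ns]] iU; first by left; exact: (corr_isol c1 r).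
  right; split; first exact: (corr_isol c2 r).
  by move=> /(sink_sec_iso (iso_sym iU)).
- move=> U W W' [r|[r ns]] [r'|[r' ns']].
  + exact: (corr_funl c1 r).
  + by have := bgp_sec r.
  + by have := bgp_sec r'.
  + exact: (corr_funl c2 r).
- move=> U U' W [r|[r ns]] [r'|[r' ns']].
  + exact: (corr_funr c1 r).
  + by have := swap_exclusive r' (bgp_ret r).
  + by have := swap_exclusive r (bgp_ret r').
  + exact: (corr_funr c2 r).
- move=> U bU; have [sU|nsU] := pselect (sink_sec v U).
    have [W r] := bgp_total sU; exists W; split; first by left.
    exact/(bgp_basic_rigid i r).
  have [_ _ rU _] := bU; have [//|sU] := rigid_sink_split rU.
  have [W r] := swap_total sU; exists W; split; first by right.
  exact/(swap_basic_rigid i r).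
- move=> W bW; have [sW|nsW] := pselect (source_ret W).
    have [U r] := bgp_surj sW; exists U; split; first by left.
    exact/(bgp_basic_rigid i r).
  have [_ _ rW _] := bW; have [//|sW] := rigid_source_split rW.
  have [U r] := swap_surj sW; exists U; split; last exact/(swap_basic_rigid i r).
  by right; split=> // /(swap_source_ret r).
Qed.

End Reflection.

Theorem theoremA3 (k : fieldType) (Q : quiver) (n : nat)
    (hQ : acyclic Q) (hn : #|vertex Q| = n)
    (v : vertex Q) (hv : is_sink v) (i : nat) (hi : (i <= n)%N) :
  exists f : rigid_classes (path_algebra k Q) i ->
             rigid_classes (path_algebra k (mutation v)) i,
    bijective f.
Proof. exact: rigid_classes_mutation. Qed.
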